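(* Let $n\geq 1$ be an integer and let $q=2^{2n+1}$. Then the Suzuki group ${}^2B_2(q)$ has a strongly real Beauville structure of type $((q-1,q-1,q-1),(d_1,d_2,2))$, where $d_1$ and $d_2$ are odd and coprime to $q-1$.
   Context: Let $G$ be a finite group. For $x,y\in G$ let $\Sigma(x,y):=\bigcup_{i=1}^{|G|}\bigcup_{g\in G}\{(x^i)^g,(y^i)^g,((xy)^i)^g\}$, where $a^g$ denotes the conjugate of $a$ by $g$. A Beauville structure (of unmixed type) for $G$ is a pair of generating pairs $\{\{x_1,y_1\},\{x_2,y_2\}\}$ with $x_i,y_i\in G$, such that $\langle x_1,y_1\rangle=\langle x_2,y_2\rangle=G$ and $\Sigma(x_1,y_1)\cap\Sigma(x_2,y_2)=\{e\}$, where $e$ is the identity element of $G$. The structure has type $((o(x_1),o(y_1),o(x_1y_1)),(o(x_2),o(y_2),o(x_2y_2)))$, where $o(g)$ denotes the order of $g$. A Beauville structure $\{\{x_1,y_1\},\{x_2,y_2\}\}$ is strongly real if there exist an automorphism $\phi\in\mathrm{Aut}(G)$ and elements $g_1,g_2\in G$ such that $g_i\phi(x_i)g_i^{-1}=x_i^{-1}$ and $g_i\phi(y_i)g_i^{-1}=y_i^{-1}$ for $i=1,2$. The group ${}^2B_2(q)$, $q=2^{2n+1}$, is the Suzuki group over the field of order $q$ (simple for $n\geq1$). *)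

(* Defs.v *)
From HB Require Import structures.
From mathcomp Require Import all_boot all_order all_algebra all_fingroup.
Set Implicit Arguments.
Unset Strict Implicit.
Unset Printing Implicit Defensive.

Import GRing.Theory.

Section Beauville.
Local Open Scope group_scope.
Variables (gT : finGroupType) (G : {group gT}).
Implicit Types (x y : gT) (X : gT * gT).

Definition beauville_Sigma x y : {set gT} :=
  \bigcup_(1 <= i < #|G|.+1) \bigcup_(g in G)
    [set (x ^+ i) ^ g; (y ^+ i) ^ g; ((x * y) ^+ i) ^ g].

(* [<<A>> = G] alone forces [A \subset G], so membership is implied. *)
Definition generating_pair X : Prop := <<[set X.1; X.2]>> = G.

(* The generating pairs are ordered: strong reality and the type below refer *)
(* to the individual x_i, y_i.                                               *)
Definition beauville_structure X1 X2 : Prop :=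
  [/\ generating_pair X1, generating_pair X2
    & beauville_Sigma X1.1 X1.2 :&: beauville_Sigma X2.1 X2.2 = [set 1]].

Definition strongly_real X1 X2 : Prop :=
  exists2 phi : {perm gT}, phi \in Aut G &
  exists g1 g2 : gT,
    [/\ g1 \in G, g2 \in G,
        g1 * phi X1.1 * g1^-1 = X1.1^-1 /\ g1 * phi X1.2 * g1^-1 = X1.2^-1
      & g2 * phi X2.1 * g2^-1 = X2.1^-1 /\ g2 * phi X2.2 * g2^-1 = X2.2^-1].

Definition beauville_type X1 X2 : (nat * nat * nat) * (nat * nat * nat) :=
  ((#[X1.1], #[X1.2], #[X1.1 * X1.2]), (#[X2.1], #[X2.2], #[X2.1 * X2.2])).

End Beauville.

(* Suzuki's matrix description of 2B2(q), for a field F with q = 2^(2n+1)    *)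
(* elements. The map theta : x |-> x^(2^(n+1)) is then the automorphism of F *)
(* with theta^2 equal to the Frobenius map x |-> x^2.                        *)
Section Suzuki.
Local Open Scope ring_scope.
Variables (n : nat) (F : finFieldType).

Definition suzuki_theta (x : F) : F := x ^+ (2 ^ n.+1).
Local Notation theta := suzuki_theta.

Definition mx4_of_rows (s : seq (seq F)) : 'M[F]_4 :=
  \matrix_(i < 4, j < 4) (nth [::] s i)`_j.

Definition suzuki_S (a b : F) : 'M[F]_4 := mx4_of_rows
  [:: [:: 1; 0; 0; 0];
      [:: a; 1; 0; 0];
      [:: b; theta a; 1; 0];
      [:: a ^+ 2 * theta a + a * b + theta b; a * theta a + b; a; 1]].

Definition suzuki_M (l : F) : 'M[F]_4 := mx4_of_rows
  [:: [:: l * theta l; 0; 0; 0];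
      [:: 0; l; 0; 0];
      [:: 0; 0; l^-1; 0];
      [:: 0; 0; 0; (l * theta l)^-1]].

Definition suzuki_T : 'M[F]_4 := mx4_of_rows
  [:: [:: 0; 0; 0; 1];
      [:: 0; 0; 1; 0];
      [:: 0; 1; 0; 0];
      [:: 1; 0; 0; 0]].

(* All these matrices have determinant 1 (for l != 0), so that none of them  *)
(* is lost in the passage to the type {'GL_4[F]} of invertible matrices.     *)
Definition suzuki_generators : {set {'GL_4[F]}} :=
  [set g : {'GL_4[F]} |
     [|| [exists a, exists b, GLval g == suzuki_S a b],
         [exists l, (l != 0) && (GLval g == suzuki_M l)]
       | GLval g == suzuki_T]].

Definition suzuki_group : {group {'GL_4[F]}} := <<suzuki_generators>>%G.

End Suzuki.

(* Main.v *)
Require Import Defs.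
From mathcomp Require Import all_boot all_order all_algebra all_fingroup.
From mathcomp Require Import all_solvable finfield ring zify.

(* If [r], [s], [t] are involutions, then [s] inverts both [r s] and [s t],
   whose product is [r t].  With [phi = 1] it therefore suffices to find two
   triples of involutions such that [r s] and [s t] generate [G], the products
   having orders (q-1, q-1, q-1) for one triple and (odd, odd, 2), coprime to
   q-1, for the other; coprimality of the orders separates the two Sigma sets.

   The triples are built from the involutions [T M(l)] and the elements [C(b)]
   of the root subgroup commuting with [T], where [C(b) C(c) = C(b + c)] and
   [C(1) = T].  The characteristic polynomial of [T M(l) C(b)] depends only on
   its trace [theta(b) tr M(l)].  Let [l] generate the multiplicative group.
   - [T M(l)], [T M(l^-1)], [C(b)] with [theta(b) = tr M(l)]: the traces of the
     last two products are [tr M(l)^2 = tr M(l^2)], so they have order q-1.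
   - [C(b)], [T M(l)], [C(1 + b)]: the two traces add up to [tr M(l)], and since
     at least half of the elements of [F], but neither 0 nor [tr M(l)], are
     traces of elements without eigenvalue in [F], the pigeonhole principle
     lets both traces be of this kind; such elements have order prime to
     2(q-1).

   Both triples generate a subgroup [H] that contains the torus [D] of all
   [M(l)], [T] and a Klein four-group.  If [H] meets the unipotent group [Q] of
   all [S(a, b)], the action of [D] shows [H = G].  Otherwise a Sylow
   2-subgroup [E] of [H] and [D] are trivial intersection subgroups whose
   normalizers in [H] are [E] and [D<T>], and as [#|E| >= 4] the conjugates of
   [E] and [D] would have more than [#|H|] elements.  Finally [r s] and [s t]
   generate a subgroup of index at most 2, which contains all squares. *)

Set Implicit Arguments.
Unset Strict Implicit.
Unset Printing Implicit Defensive.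

Import GRing.Theory.

(** * Sigma sets and orders of elements *)

Section SigmaOrders.
Local Open Scope group_scope.
Variables (gT : finGroupType) (H : {group gT}).
Implicit Types (x y r : gT) (i j : nat).

Lemma Sigma_order r x y i : x \in H -> y \in H ->
  (#[x] %| i)%N -> (#[y] %| i)%N -> (#[x * y] %| i)%N ->
  r \in beauville_Sigma H x y -> (#[r] %| i)%N.
Proof.
move=> Hx Hy xi yi xyi.
suff : beauville_Sigma H x y \subset [set z | #[z] %| i]%N.
  by move/subsetP/(_ r); rewrite inE.
apply: (big_ind (fun A : {set gT} => A \subset [set z | #[z] %| i]%N)).
- exact: sub0set.
- by move=> A B sA sB; rewrite subUset sA.
move=> j _; apply/bigcupsP=> g _; apply/subsetP=> z; rewrite !inE.
by case/orP=> [/orP[]|] /eqP->; rewrite orderJ (dvdn_trans (orderXdvd _ _)).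
Qed.

Lemma Sigma_1 x y : x \in H -> 1 \in beauville_Sigma H x y.
Proof.
(* The identity appears at the last exponent [#|H|] of the range. *)
move=> Hx; rewrite /beauville_Sigma big_nat_recr ?cardG_gt0 //= inE; apply/orP; right.
apply/bigcupP; exists 1 => //; rewrite !inE conjg1.
by rewrite (eqP (_ : x ^+ #|H| == 1)) ?eqxx // -order_dvdn order_dvdG.
Qed.

(** The order of a common element divides both [i] and [j]. *)
Lemma Sigma_coprime x1 y1 x2 y2 i j :
  x1 \in H -> y1 \in H -> x2 \in H -> y2 \in H ->
  (#[x1] %| i)%N -> (#[y1] %| i)%N -> (#[(x1 * y1)%g] %| i)%N ->
  (#[x2] %| j)%N -> (#[y2] %| j)%N -> (#[(x2 * y2)%g] %| j)%N -> coprime i j ->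
  beauville_Sigma H x1 y1 :&: beauville_Sigma H x2 y2 = [set 1].
Proof.
move=> Hx1 Hy1 Hx2 Hy2 o1 o2 o3 o4 o5 o6 cop; apply/setP=> r; rewrite !inE.
apply/andP/eqP=> [[r1 r2]|->]; last by rewrite !Sigma_1.
apply/eqP; rewrite -order_eq1 -dvdn1 -(eqP cop) dvdn_gcd.
by rewrite (Sigma_order Hx1 Hy1 o1 o2 o3 r1) (Sigma_order Hx2 Hy2 o4 o5 o6 r2).
Qed.

End SigmaOrders.

(** * The field and its automorphism theta *)

Section Field.
Local Open Scope ring_scope.
Variables (n : nat) (F : finFieldType).
Hypothesis hF : #|F| = (2 ^ (2 * n + 1))%N.
Local Notation th := (@suzuki_theta n F).
Implicit Types a b l s t x y : F.

Lemma suzuki_pchar : 2%N \in [pchar F].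
Proof. exact: card_finPcharP hF isT. Qed.

Lemma two_eq0 : 2%:R = 0 :> F.
Proof. exact: pcharf0 suzuki_pchar. Qed.

Lemma natr_char2 k : k%:R = (odd k)%:R :> F.
Proof.
rewrite -{1}(odd_double_half k) natrD -muln2 natrM two_eq0 mulr0.
exact: addr0.
Qed.

Lemma addxx x : x + x = 0.
Proof. by ring: two_eq0. Qed.

Lemma add_eq0 x y : (x + y == 0) = (x == y).
Proof. by rewrite -[y in RHS](oppr_pchar2 suzuki_pchar) addr_eq0. Qed.

Lemma thetaD x y : th (x + y) = th x + th y.
Proof.
by apply: exprDn_pchar; rewrite pnatX pnatE // suzuki_pchar.
Qed.

Lemma thetaM x y : th (x * y) = th x * th y.
Proof. exact: exprMn. Qed.

Lemma thetaV x : th x^-1 = (th x)^-1.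
Proof. exact: exprVn. Qed.

Lemma thetaX x k : th (x ^+ k) = th x ^+ k.
Proof. by rewrite /suzuki_theta -!exprM mulnC. Qed.

Lemma theta0 : th 0 = 0.
Proof. by rewrite /suzuki_theta expr0n expn_eq0. Qed.

Lemma theta1 : th 1 = 1.
Proof. exact: expr1n. Qed.

Lemma theta_eq0 x : (th x == 0) = (x == 0).
Proof. by rewrite /suzuki_theta expf_eq0 expn_gt0. Qed.

(** Applying [theta] twice raises to the power [2^(2n+2) = 2q], and [x^q = x] in [F]. *)
Lemma thetaK x : th (th x) = x ^+ 2.
Proof.
rewrite /suzuki_theta -exprM -expnD addSnnS -addSnnS.
have -> : (n.+1 + n.+1 = (2 * n + 1).+1)%N by rewrite addn1 mul2n -addnn addnS.
by rewrite expnS mulnC exprM -hF expf_card.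
Qed.

Lemma theta_inj : injective th.
Proof.
move=> x y e; apply/eqP; rewrite -add_eq0 -(theta_eq0 (x + y)) thetaD e.
by rewrite addxx.
Qed.

Lemma theta_eq1 x : (th x == 1) = (x == 1).
Proof. by rewrite -[RHS](inj_eq theta_inj) theta1. Qed.

Lemma sqr_eq1 x : (x ^+ 2 == 1) = (x == 1).
Proof. by rewrite -thetaK !theta_eq1. Qed.

(** Applying [theta] to [x theta(x) = 1] gives [x^2 theta(x) = 1]; the quotient of the two equations
    is [x = 1]. *)
Lemma mul_theta_eq1 x : (x * th x == 1) = (x == 1).
Proof.
apply/idP/idP=> /eqP e; last by rewrite e theta1 mulr1.
have := congr1 th e; rewrite thetaM thetaK theta1 expr2 mulrCA [th x * x]mulrC e mulr1.
by move->.
Qed.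

(** The product is the image of [x theta(x)] under [theta]. *)
Lemma sqr_mul_theta_eq1 x : (x ^+ 2 * th x == 1) = (x == 1).
Proof.
by rewrite -[RHS]mul_theta_eq1 -[RHS]theta_eq1 thetaM thetaK mulrC.
Qed.

(* [theta] would permute the two roots of z^2 + z + 1, so [theta^2] would fix
   them, while it squares them. *)
Lemma no_cube_root s : s ^+ 2 + s + 1 != 0.
Proof.
apply/eqP=> e; have e2 : s ^+ 2 = s + 1 by apply/eqP; rewrite -add_eq0 addrA e.
have e3 : (th s + s) * (th s + s + 1) = 0.
  have := congr1 th e2; rewrite thetaD thetaX theta1 => e4.
  by ring: two_eq0 e2 e4.
have : s ^+ 2 = s.
  rewrite -thetaK; move/eqP: e3; rewrite mulf_eq0 -addrA !add_eq0.
  by case/orP=> /eqP e5; rewrite !e5 ?thetaD ?theta1 ?e5 //; ring: two_eq0.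
rewrite e2 => e6; have /eqP := oner_neq0 F; apply.
by apply: (addrI s); rewrite e6 addr0.
Qed.

End Field.

Local Open Scope ring_scope.

(* [ring] and [field] only rewrite a coefficient that is literally the
   left-hand side of a given equation, hence one equation for each of them. *)
Ltac char2_ring hF :=
  ring: (natr_char2 hF 2 : 2%:R = 0) (natr_char2 hF 3 : 3%:R = 1)
    (natr_char2 hF 4 : 4%:R = 0) (natr_char2 hF 5 : 5%:R = 1)
    (natr_char2 hF 6 : 6%:R = 0) (natr_char2 hF 7 : 7%:R = 1)
    (natr_char2 hF 8 : 8%:R = 0) (natr_char2 hF 9 : 9%:R = 1)
    (natr_char2 hF 10 : 10%:R = 0) (natr_char2 hF 11 : 11%:R = 1)
    (natr_char2 hF 12 : 12%:R = 0) (natr_char2 hF 13 : 13%:R = 1)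
    (natr_char2 hF 14 : 14%:R = 0) (natr_char2 hF 15 : 15%:R = 1)
    (natr_char2 hF 16 : 16%:R = 0).

Ltac char2_field hF :=
  field: (natr_char2 hF 2 : 2%:R = 0) (natr_char2 hF 3 : 3%:R = 1)
    (natr_char2 hF 4 : 4%:R = 0) (natr_char2 hF 5 : 5%:R = 1)
    (natr_char2 hF 6 : 6%:R = 0) (natr_char2 hF 7 : 7%:R = 1)
    (natr_char2 hF 8 : 8%:R = 0) (natr_char2 hF 9 : 9%:R = 1)
    (natr_char2 hF 10 : 10%:R = 0) (natr_char2 hF 11 : 11%:R = 1)
    (natr_char2 hF 12 : 12%:R = 0) (natr_char2 hF 13 : 13%:R = 1)
    (natr_char2 hF 14 : 14%:R = 0) (natr_char2 hF 15 : 15%:R = 1)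
    (natr_char2 hF 16 : 16%:R = 0).

Local Close Scope ring_scope.

Section Ovoid.
Local Open Scope ring_scope.
Variables (n : nat) (F : finFieldType).
Hypothesis hF : #|F| = (2 ^ (2 * n + 1))%N.
Local Notation th := (@suzuki_theta n F).
Implicit Types a b z : F.
Let thetaE := (thetaD hF, thetaM, thetaV, thetaX, thetaK hF, @theta0, @theta1).

(* The bottom left entry of [S(a, b)]; the points (1 : a : b : ovoid a b) and
   (0 : 0 : 0 : 1) form the Suzuki-Tits ovoid. *)
Definition ovoid a b := a ^+ 2 * th a + a * b + th b.

(* For [a != 0] put [b = a theta(a) z]; then [z + theta z = 1] would give
   [z^2 = theta (theta z) = z]. *)
Lemma ovoid_eq0 a b : (ovoid a b == 0) = (a == 0) && (b == 0).
Proof.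
rewrite /ovoid; have [->|a0] := eqVneq a 0.
  by rewrite expr2 !mul0r !add0r theta_eq0.
have t0 : th a != 0 by rewrite theta_eq0.
have [z ->] : exists z, b = a * th a * z.
  by exists (b / (a * th a)); field; rewrite a0 t0.
rewrite !thetaE /=; apply/negbTE.
rewrite [X in X != 0](_ : _ = a ^+ 2 * th a * (1 + z + th z)); last by ring.
rewrite !mulf_neq0 ?expf_neq0 //; apply/eqP=> e.
have tz : th z = 1 + z by apply/eqP; rewrite -(add_eq0 hF) addrC e.
have := thetaK hF z; rewrite tz !thetaE tz.
have -> : 1 + (1 + z) = z by char2_ring hF.
move=> e2; have /eqP : z * (z + 1) = 0.
  by apply/eqP; rewrite mulrDr mulr1 (add_eq0 hF) -expr2 -e2.
rewrite mulf_eq0 (add_eq0 hF) => /orP[] /eqP z0; move/eqP: tz; rewrite z0 !thetaE.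
  by rewrite addr0 eq_sym oner_eq0.
by rewrite (addxx hF) oner_eq0.
Qed.

End Ovoid.

(** * Groups with the Suzuki relations *)

Section Relations.
Local Open Scope group_scope.
Variables (n : nat) (F : finFieldType).
Local Notation th := (@suzuki_theta n F).
Local Notation q := #|F|.
Implicit Types (a b c d k l m u v : F).

(** An interface that keeps matrices out of the group theory. [rel_T_S_T] drives the Bruhat
    decomposition; the three fields after it replace the comparison of matrix entries and make
    normal forms unique. *)
Record suzuki_relations (gT : finGroupType) (G : {group gT})
    (S : F -> F -> gT) (M : F -> gT) (T : gT) : Prop := SuzukiRelations {
  rel_S_mul : forall a b c d,
    S a b * S c d = S (a + c)%R (b + d + th a * c)%R;
  rel_M_mul : forall l m, l != 0%R -> m != 0%R -> M l * M m = M (l * m)%R;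
  rel_S_mulM : forall a b l, l != 0%R ->
    S a b * M l = M l * S (th l * a)%R (l ^+ 2 * th l * b)%R;
  rel_M_mulT : forall l, l != 0%R -> M l * T = T * M l^-1%R;
  rel_T_mul : T * T = 1;
  rel_T_S_T : forall a b, ovoid n a b != 0%R ->
    T * S a b * T * S ((b + a * th a) / ovoid n a b)%R (a / ovoid n a b)%R =
    S (b / ovoid n a b)%R (a / ovoid n a b)%R * T *
    M (ovoid n a b / th (ovoid n a b))%R;
  rel_SM_eq1 : forall a b l, l != 0%R ->
    S a b * M l = 1 -> [/\ a = 0%R, b = 0%R & l = 1%R];
  rel_SM_neqT : forall a b l, l != 0%R -> S a b * M l <> T;
  rel_TST_SM : forall a b c d l, l != 0%R ->
    T * S a b * T = S c d * M l -> a = 0%R /\ b = 0%R;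
  rel_gen : G :=: <<[set S p.1 p.2 | p : F * F]
                      :|: [set M l | l : F & l != 0%R] :|: [set T]>> }.

Variables (gT : finGroupType) (G : {group gT}).
Variables (S : F -> F -> gT) (M : F -> gT) (T : gT).
Arguments S (_ _)%_R.
Arguments M _%_R.
Hypothesis hF : #|F| = (2 ^ (2 * n + 1))%N.
Hypothesis n_gt0 : (0 < n)%N.
Hypothesis relG : suzuki_relations G S M T.
Implicit Types g x y z : gT.
Let S_mul := rel_S_mul relG.
Let M_mul := rel_M_mul relG.
Let S_mulM := rel_S_mulM relG.
Let M_mulT := rel_M_mulT relG.
Let T_mul := rel_T_mul relG.
Let T_S_T := rel_T_S_T relG.
Let SM_eq1 := rel_SM_eq1 relG.
Let SM_neqT := rel_SM_neqT relG.
Let TST_SM := rel_TST_SM relG.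
Let defG := rel_gen relG.

Lemma S00 : S 0 0 = 1.
Proof.
by apply: (mulgI (S 0 0)); rewrite S_mul mulg1 mulr0 !addr0.
Qed.

Lemma M1 : M 1 = 1.
Proof. by apply: (mulgI (M 1)); rewrite M_mul ?oner_eq0 // mulg1 mulr1. Qed.

Lemma S_inv a b : (S a b)^-1 = S a (b + th a * a).
Proof.
apply/eqP; rewrite eq_invg_mul S_mul (addxx hF) addrA (addxx hF) add0r (addxx hF).
by rewrite S00.
Qed.

Lemma M_inv l : l != 0%R -> (M l)^-1 = M l^-1.
Proof.
move=> l0; apply/eqP; rewrite eq_invg_mul M_mul ?invr_eq0 // divff //.
by rewrite M1.
Qed.

Lemma T_inv : T^-1 = T.
Proof. by apply/eqP; rewrite eq_invg_mul T_mul. Qed.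

Lemma M_mulS a b l : l != 0%R ->
  M l * S a b = S ((th l)^-1 * a) ((l ^+ 2 * th l)^-1 * b) * M l.
Proof.
move=> l0; have tl0 : th l != 0%R by rewrite theta_eq0.
rewrite S_mulM //.
by congr (M l * S _ _); field; rewrite ?l0 tl0.
Qed.

Lemma T_mulM l : l != 0%R -> T * M l = M l^-1 * T.
Proof. by move=> l0; rewrite M_mulT ?invr_eq0 // invrK. Qed.

Lemma SM_inj a b l c d m : l != 0%R -> m != 0%R ->
  S a b * M l = S c d * M m -> [/\ a = c, b = d & l = m].
Proof.
move=> l0 m0 e; have : (S c d)^-1 * (S a b * M l) * (M m)^-1 = 1.
  by rewrite e mulKg mulgV.
rewrite S_inv !mulgA S_mul -mulgA M_inv // M_mul ?invr_eq0 //.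
case/SM_eq1 => [|e1 e2 e3]; first by rewrite mulf_neq0 ?invr_eq0.
have eac : a = c by apply/eqP; rewrite eq_sym -(add_eq0 hF) e1.
split=> //; last by rewrite -(divfK m0 l) e3 mul1r.
apply/eqP; rewrite eq_sym -(add_eq0 hF) -[X in _ == X]e2 eac; apply/eqP.
by char2_ring hF.
Qed.

Lemma S_inj a b c d : S a b = S c d -> a = c /\ b = d.
Proof.
move=> e; have one0 := oner_neq0 F.
by have [|||-> -> _] := @SM_inj a b 1%R c d 1%R; rewrite ?e.
Qed.

Lemma M_inj l m : l != 0%R -> m != 0%R -> M l = M m -> l = m.
Proof.
move=> l0 m0 e.
by have [|||_ _ ->] := @SM_inj 0%R 0%R l 0%R 0%R m; rewrite ?e.
Qed.

(** * The unipotent group, the torus and the Borel subgroup *)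

Definition unip : {set gT} := [set S p.1 p.2 | p : F * F].
Definition torus : {set gT} := [set M l | l : F & l != 0%R].

Lemma unipP x : reflect (exists a b, x = S a b) (x \in unip).
Proof.
apply: (iffP imsetP) => [[[a b] _ ->]|[a [b ->]]]; first by exists a, b.
by exists (a, b).
Qed.

Lemma torusP x : reflect (exists2 l, l != 0%R & x = M l) (x \in torus).
Proof.
by apply: (iffP imsetP) => [[l]|[l l0 ->]]; rewrite ?inE;
  [exists l | exists l; rewrite ?inE].
Qed.

Lemma unip_group_set : group_set unip.
Proof.
apply/group_setP; split=> [|x y]; first by apply/unipP; exists 0%R, 0%R; rewrite S00.
case/unipP=> [a [b ->]] /unipP[c [d ->]]; apply/unipP.
by rewrite S_mul; do 2!eexists.
Qed.

Canonical unip_group := group unip_group_set.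

Lemma torus_group_set : group_set torus.
Proof.
apply/group_setP; split=> [|x y].
  by apply/torusP; exists 1%R; rewrite ?M1 ?oner_eq0.
case/torusP=> l l0 -> /torusP[m m0 ->]; apply/torusP.
by exists (l * m)%R; rewrite ?M_mul ?mulf_neq0.
Qed.

Canonical torus_group := group torus_group_set.

Local Notation Q := unip.
Local Notation D := torus.

Lemma mem_S a b : S a b \in Q.
Proof. by apply/unipP; exists a, b. Qed.

Lemma mem_M l : l != 0%R -> M l \in D.
Proof. by move=> l0; apply/torusP; exists l. Qed.

Lemma torus_norm_unip : D \subset 'N(Q).
Proof.
apply/subsetP=> _ /torusP[l l0 ->]; rewrite inE; apply/subsetP=> _ /imsetP[x Qx ->].
case/unipP: Qx => a [b ->]; rewrite conjgE S_mulM // mulKg; exact: mem_S.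
Qed.

Definition borel : {group gT} := (Q <*> D)%G.
Local Notation B := borel.

Lemma borelE : B :=: Q * D.
Proof. exact: (norm_joinEr torus_norm_unip). Qed.

Lemma borelP x : reflect (exists a b l, l != 0%R /\ x = S a b * M l) (x \in B).
Proof.
rewrite borelE; apply: (iffP mulsgP) => [[y z /unipP[a [b ey]] /torusP[l l0 ez] ->]|].
  by exists a, b, l; rewrite ey ez.
move=> [a [b [l [l0 ->]]]]; exists (S a b) (M l) => //; first exact: mem_S.
exact: mem_M.
Qed.

Lemma mem_SM a b l : l != 0%R -> S a b * M l \in B.
Proof. by move=> l0; apply/borelP; exists a, b, l. Qed.

Lemma unip_sub_borel : Q \subset B. Proof. exact: joing_subl. Qed.

Lemma torus_sub_borel : D \subset B. Proof. exact: joing_subr. Qed.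

Lemma unip_normal : Q <| B.
Proof.
by rewrite /normal unip_sub_borel join_subG normG torus_norm_unip.
Qed.

(** * Bruhat decomposition and group order *)

Lemma mem_T : T \in G.
Proof. by rewrite defG mem_gen // !inE eqxx orbT. Qed.

Lemma unip_sub : Q \subset G.
Proof. by rewrite defG sub_gen // -setUA subsetUl. Qed.

Lemma torus_sub : D \subset G.
Proof. by rewrite defG sub_gen // setUAC subsetUr. Qed.

Lemma borel_sub : B \subset G.
Proof. by rewrite join_subG unip_sub torus_sub. Qed.

(** This is the double coset [B T B]: torus elements on the right of [T] move to its left, so the
    factor [Q] suffices and makes the expression unique. *)
Definition big_cell := (B :* T) * Q.

Lemma big_cellP x :
  reflect (exists y a b, y \in B /\ x = y * T * S a b) (x \in big_cell).
Proof.
apply: (iffP mulsgP) => [[y z /rcosetP[w Bw ey] /unipP[a [b ez]] ->]|].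
  by exists w, a, b; rewrite ey ez.
case=> y [a [b [By ->]]]; exists (y * T) (S a b) => //; last exact: mem_S.
by apply/rcosetP; exists y.
Qed.

Lemma T_S_T_big a b : ovoid n a b != 0%R -> T * S a b * T \in big_cell.
Proof.
move=> f0; have tf0 : th (ovoid n a b) != 0%R by rewrite theta_eq0.
have k0 : (ovoid n a b / th (ovoid n a b))%R != 0%R by rewrite mulf_neq0 ?invr_eq0.
have /(canRL (mulgK _)) -> := T_S_T f0.
rewrite -(mulgA (S _ _) T) T_mulM // S_inv; apply/big_cellP.
do 3!eexists; split; last by rewrite mulgA.
by apply/borelP; do 3!eexists; split; last by []; rewrite invr_eq0.
Qed.

(** As the union contains 1, it suffices that right multiplication by the generators preserves it.
    The only case that needs [rel_T_S_T] is [y T S(a, b) T] with nonzero ovoid value; if that value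
    is 0, the product is [y]. *)
Lemma bruhat_decomposition : G :=: B :|: big_cell.
Proof.
apply/eqP; rewrite eqEsubset subUset borel_sub /=; apply/andP; split; last first.
  by rewrite mul_subG ?unip_sub // mul_subG ?borel_sub // sub1set mem_T.
pose X := B :|: big_cell.
suffices sG : G \subset 'N(X | 'R).
  apply/subsetP=> x /(subsetP sG) Nx; rewrite -(mul1g x).
  by rewrite (astabs_act 1 Nx) inE group1.
rewrite defG gen_subG; apply/subsetP=> g gen_g; rewrite !inE /=.
apply/subsetP=> x; rewrite !inE /= => /orP[Bx|/big_cellP[y [a [b [By ->]]]]].
  move: gen_g; rewrite !inE => /orP[/orP[Qg|Dg]|/eqP->].
  - by rewrite groupM // (subsetP unip_sub_borel).
  - by rewrite groupM // (subsetP torus_sub_borel).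
  - apply/orP; right; apply/big_cellP; exists x, 0%R, 0%R.
    by rewrite S00 mulg1.
move: gen_g; rewrite !inE => /orP[/orP[/unipP[c [d ->]]|/torusP[l l0 ->]]|/eqP->].
- apply/orP; right; apply/big_cellP; rewrite -mulgA S_mul.
  by exists y; do 2!eexists; split.
- apply/orP; right; apply/big_cellP; rewrite -mulgA S_mulM // mulgA.
  rewrite -(mulgA y) T_mulM // mulgA; do 3!eexists; split; last by [].
  by rewrite groupM // (subsetP torus_sub_borel) // mem_M ?invr_eq0.
have [|f0] := eqVneq (ovoid n a b) 0%R.
  move/eqP; rewrite (ovoid_eq0 hF) => /andP[/eqP-> /eqP->].
  by rewrite S00 mulg1 -mulgA T_mul mulg1 By.
apply/orP; right; rewrite -2!mulgA (mulgA T).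
have /big_cellP[z [c [d [Bz ->]]]] := T_S_T_big f0.
by apply/big_cellP; exists (y * z), c, d; rewrite groupM // !mulgA.
Qed.

Lemma card_unip : #|Q| = (q ^ 2)%N.
Proof.
rewrite card_imset ?card_prod ?mulnn // => -[a b] [c d] /=.
by case/S_inj=> -> ->.
Qed.

Lemma card_torus : #|D| = q.-1.
Proof.
rewrite card_in_imset => [|l m]; last by rewrite !inE; apply: M_inj.
by rewrite -(cardC1 0%R); apply: eq_card => x; rewrite !inE.
Qed.

Lemma mem_unip_torus x : x \in Q -> x \in D -> x = 1.
Proof.
move=> /unipP[a [b ->]] /torusP[l l0 e].
have [|||-> -> _] := @SM_inj a b 1%R 0%R 0%R l; rewrite ?oner_eq0 ?S00 //.
by rewrite e M1 mulg1 mul1g.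
Qed.

Lemma card_borel : #|B| = (q ^ 2 * q.-1)%N.
Proof.
rewrite borelE TI_cardMg ?card_unip ?card_torus //; apply/trivgP/subsetP=> x.
by rewrite !inE => /andP[Qx Dx]; rewrite (mem_unip_torus Qx Dx).
Qed.

Lemma conjT x : x ^ T = T * x * T.
Proof. by rewrite conjgE T_inv mulgA. Qed.

Lemma mem_unip_conjT x : x \in Q -> x ^ T \in B -> x = 1.
Proof.
move=> /unipP[a [b ->]]; rewrite conjT => /borelP[c [d [l [l0]]]].
by case/(TST_SM l0)=> -> ->; rewrite S00.
Qed.

Lemma big_cell_inj y z a b c d : y \in B -> z \in B ->
  y * T * S a b = z * T * S c d -> [/\ y = z, a = c & b = d].
Proof.
move=> By Bz e; have Qx : S a b * (S c d)^-1 \in Q.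
  by rewrite groupM ?groupV ?mem_S.
have e2 : (S a b * (S c d)^-1) ^ T = y^-1 * z.
  rewrite conjT; apply: (mulgI y); rewrite mulKVg; apply: (mulIg (T * S c d)).
  by rewrite -!mulgA (mulgA T T) T_mul mul1g mulVg mulg1 !mulgA.
have e3 : S a b = S c d.
  apply/eqP; rewrite eq_mulgV1; apply/eqP; apply: mem_unip_conjT => //.
  by rewrite e2 groupM ?groupV.
have [-> ->] := S_inj e3; split=> //.
by apply: (mulIg T); apply: (mulIg (S a b)); rewrite e e3.
Qed.

Lemma card_big_cell : #|big_cell| = (#|B| * q ^ 2)%N.
Proof.
pose f (p : gT * (F * F)) := p.1 * T * S p.2.1 p.2.2.
have -> : big_cell = f @: setX B [set: F * F].
  apply/setP=> x; apply/big_cellP/imsetP=> [[y [a [b [By ->]]]]|].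
    by exists (y, (a, b)); rewrite ?inE ?By.
  by case=> -[y [a b]]; rewrite !inE andbT /= => By ->; exists y, a, b.
rewrite card_in_imset ?cardsX ?cardsT ?card_prod ?mulnn //.
move=> [y [a b]] [z [c d]]; rewrite !inE !andbT /= => By Bz.
by rewrite /f /= => /(big_cell_inj By Bz)[-> -> ->].
Qed.

Lemma card_suzuki : #|G| = (q ^ 2 * q.-1 * (q ^ 2).+1)%N.
Proof.
rewrite bruhat_decomposition cardsU card_big_cell card_borel.
suffices -> : B :&: big_cell = set0 by rewrite cards0 subn0 mulnS.
apply/setP=> x; rewrite !inE; apply/andP=> -[Bx /big_cellP[y [a [b [By e]]]]].
have : T \in B.
  have -> : T = y^-1 * x * (S a b)^-1 by rewrite e !mulgA mulVg mul1g mulgK.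
  by rewrite !groupM ?groupV // (subsetP unip_sub_borel) // mem_S.
by case/borelP=> c [d [l [l0]]] /esym/(SM_neqT l0).
Qed.

(** * Trivial intersection properties of the unipotent group and the torus *)

Lemma unip_TI x g : x \in Q -> x != 1 -> g \in G -> x ^ g \in Q -> g \in B.
Proof.
move=> Qx x1; rewrite bruhat_decomposition inE => /orP[//|].
(* For [g = y T S(a, b)], conjugation by [T] would carry [x ^ y], a nontrivial element of [Q], into
   [Q] again. *)
case/big_cellP=> y [a [b [By ->]]]; rewrite !conjgM => Qxg.
have Qxy : x ^ y \in Q by rewrite memJ_norm // (subsetP (normal_norm unip_normal)).
rewrite (@groupJr _ unip_group) ?mem_S // in Qxg.
have := mem_unip_conjT Qxy (subsetP unip_sub_borel _ Qxg).
by move/(canRL (conjgK _)); rewrite conj1g => /eqP; rewrite (negPf x1).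
Qed.

Lemma T_norm_torus : T \in 'N(D).
Proof.
rewrite inE; apply/subsetP=> _ /imsetP[x Dx ->]; case/torusP: Dx => l l0 ->.
by rewrite conjT -mulgA M_mulT // mulgA T_mul mul1g mem_M ?invr_eq0.
Qed.

Lemma T_neq1 : T != 1.
Proof.
apply/eqP=> e; apply: (@SM_neqT 0%R 0%R 1%R); rewrite ?oner_eq0 //.
by rewrite S00 M1 mulg1 e.
Qed.

Lemma order_T : #[T] = 2.
Proof.
by apply: nt_prime_order; rewrite ?T_neq1 // expgS expg1 T_mul.
Qed.

Definition torus_normalizer : {group gT} := (D <*> <[T]>)%G.
Local Notation N := torus_normalizer.

Lemma torus_normalizerE : N :=: D * <[T]>.
Proof. by rewrite /= norm_joinEr // cycle_subG T_norm_torus. Qed.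

Lemma torus_normalizerP x :
  reflect (exists2 l, l != 0%R & x = M l \/ x = M l * T) (x \in N).
Proof.
rewrite torus_normalizerE (cycle2g order_T); apply: (iffP mulsgP).
  case=> y z /torusP[l l0 ->]; rewrite !inE => /orP[]/eqP-> ->; exists l => //.
    by left; rewrite mulg1.
  by right.
case=> l l0 [] ->; first by exists (M l) 1; rewrite ?mulg1 ?mem_M // !inE eqxx.
by exists (M l) T; rewrite ?mem_M // !inE eqxx orbT.
Qed.

Lemma card_torus_normalizer : #|N| = (q.-1 * 2)%N.
Proof.
rewrite torus_normalizerE TI_cardMg ?card_torus -?orderE ?order_T //.
apply/trivgP/subsetP=> x; rewrite inE /= (cycle2g order_T) !inE.
case/andP=> /torusP[l l0 e] /orP[//|/eqP e2].
by case: (@SM_neqT 0%R 0%R l) => //; rewrite S00 mul1g -e e2.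
Qed.

(** Write the conjugation as [M l * g = g * M m] and compare normal forms. The unipotent parameters
    of [g] are fixed by multiplication by [theta(l)^-1] or [(l^2 theta(l))^-1], neither of which is
    1, and so they vanish. *)
Lemma torus_TI x g : x \in D -> x != 1 -> g \in G -> x ^ g \in D -> g \in N.
Proof.
move=> /torusP[l l0 ->] l1 Gg /torusP[m m0 e].
have {}l1 : l != 1%R by apply: contraNneq l1 => ->; rewrite M1.
have tl0 : th l != 0%R by rewrite theta_eq0.
have {}e : M l * g = g * M m by rewrite -e conjgE mulKVg.
have fix0 a : ((th l)^-1 * a = a)%R -> a = 0%R.
  move/eqP; have [->//|a0] := eqVneq a 0%R.
  rewrite -{2}(mul1r a) (inj_eq (mulIf a0)) invr_eq1 (theta_eq1 hF).
  by rewrite (negPf l1).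
have fix0' a : ((l ^+ 2 * th l)^-1 * a = a)%R -> a = 0%R.
  move/eqP; have [->//|a0] := eqVneq a 0%R.
  rewrite -{2}(mul1r a) (inj_eq (mulIf a0)) invr_eq1 (sqr_mul_theta_eq1 hF).
  by rewrite (negPf l1).
have nz := (mulf_neq0, invr_eq0).
apply/torus_normalizerP; move: Gg; rewrite bruhat_decomposition inE.
case/orP=> [/borelP[a [b [k [k0 eg]]]]|].
  move: e; rewrite eg mulgA M_mulS // -!mulgA !M_mul //.
  case/SM_inj=> [||/fix0-> /fix0'-> _]; rewrite ?nz // S00 mul1g.
  by exists k => //; left.
case/big_cellP=> y [c [d [/borelP[a [b [k [k0 ->]]]] eg]]].
move: e; rewrite {1}eg !mulgA M_mulS // -(mulgA _ (M l)) M_mul // => e.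
have e2 : g * M m = S a b * M (k * m^-1)%R * T * S (th m * c) (m ^+ 2 * th m * d).
  rewrite eg -!mulgA S_mulM // (mulgA T) T_mulM // !mulgA -(mulgA _ (M k)).
  by rewrite M_mul ?invr_eq0.
have [||e3 e4 e5] := @big_cell_inj _ _ _ _ _ _ _ _ (etrans e e2).
- by rewrite mem_SM ?nz ?l0.
- by rewrite mem_SM ?nz ?k0.
have [||/fix0 a0 /fix0' b0] := SM_inj _ _ e3; rewrite ?nz ?l0 ?k0 ?m0 //.
rewrite (mulrC l) => /(mulfI k0) el.
have em : m = l^-1%R by rewrite el invrK.
have c0 : c = 0%R by apply: fix0; rewrite -thetaV -em -e4.
have d0 : d = 0%R by apply: fix0'; rewrite invfM -thetaV -exprVn -em -e5.
by exists k => //; right; rewrite eg a0 b0 c0 d0 S00 mul1g mulg1.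
Qed.

(** * Sylow arguments for 2 and for the primes dividing [q - 1] *)

Lemma q_even : ~~ odd q.
Proof. by rewrite hF oddX addn1. Qed.

Lemma q_gt1 : (1 < q)%N.
Proof. by rewrite hF -{1}(expn0 2) ltn_exp2l // addn1. Qed.

Lemma q_ge8 : (8 <= q)%N.
Proof. by rewrite hF (@leq_exp2l 2 3) //; lia. Qed.

(** [q - 1] is odd and prime to [q], and [(q^2 + 1) - (q - 1)(q + 1) = 2]. *)
Lemma torus_prime p : prime p -> (p %| q.-1)%N ->
  odd p /\ ~~ (p %| q ^ 2 * (q ^ 2).+1)%N.
Proof.
move=> pr_p p_dv; have q1 := q_gt1; have eq1 := q_even.
have op : odd p.
  by apply: (dvdn_odd p_dv); rewrite -subn1 oddB ?(ltnW q1) // (negPf eq1).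
have npq : ~~ (p %| q)%N.
  apply/negP=> p_q; have : (p %| q - q.-1)%N by rewrite dvdn_sub.
  have -> : (q - q.-1 = 1)%N by lia.
  by rewrite dvdn1 => /eqP p1; rewrite p1 in pr_p.
split=> //; rewrite !Euclid_dvdM // !negb_or npq !andbT.
apply/negP=> p_q2; have : (p %| (q ^ 2).+1 - q.-1 * q.+1)%N.
  by rewrite dvdn_sub // dvdn_mulr.
have -> : ((q ^ 2).+1 - q.-1 * q.+1 = 2)%N by nia.
by rewrite dvdn_prime2 // => /eqP p2; rewrite p2 in op.
Qed.

(** The torus carries the full [p]-part of [#|G|], so one of its Sylow subgroups is also Sylow in
    [K]. *)
Lemma conj_torus (K : {group gT}) x : D \subset K -> K \subset G ->
  x \in K -> prime #[x] -> (#[x] %| q.-1)%N -> exists2 y, y \in K & x ^ y \in D.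
Proof.
move=> sDK sKG Kx pr_p p_dv; have [op npq] := torus_prime pr_p p_dv.
have [P sylP] := Sylow_exists #[x] torus_group.
have sylPK : #[x].-Sylow(K) P.
  rewrite pHallE (subset_trans (pHall_sub sylP) sDK) (card_Hall sylP) /=.
  have eG : (#|G|`_#[x] = #|D|`_#[x])%N.
    have [q0 q10] : (0 < q /\ 0 < q.-1)%N by have := q_gt1; lia.
    rewrite card_suzuki mulnAC partnM ?muln_gt0 ?expn_gt0 ?q0 //.
    by rewrite part_p'nat ?p'natE // card_torus mul1n.
  by rewrite eqn_dvd partn_dvd ?cardSg ?cardG_gt0 // -eG partn_dvd ?cardSg ?cardG_gt0.
have sXK : <[x]> \subset K by rewrite cycle_subG.
have pX : #[x].-group <[x]> by rewrite /pgroup pnat_id.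
have [y Ky sXP] := Sylow_subJ sylPK sXK pX.
exists y^-1; rewrite ?groupV //; apply: (subsetP (pHall_sub sylP)).
by rewrite -mem_conjg (subsetP sXP) ?cycle_id.
Qed.

Lemma unip_Sylow : 2.-Sylow(G) Q.
Proof.
have [q0 q10] : (0 < q /\ 0 < q.-1)%N by have := q_gt1; lia.
rewrite /pHall unip_sub /pgroup card_unip.
rewrite -divgS ?unip_sub // card_suzuki card_unip -mulnA mulKn ?expn_gt0 ?q0 //.
rewrite p'natE // dvdn2 negbK oddM oddS oddX (negPf q_even) /= andbT.
rewrite {1}hF -expnM pnatX pnat_id //=.
by have := q_even; rewrite -{1}(prednK q0) oddS negbK.
Qed.

Lemma conj_unip x : x \in G -> 2.-elt x -> exists2 y, y \in G & x ^ y \in Q.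
Proof.
move=> Gx px; have sXG : <[x]> \subset G by rewrite cycle_subG.
have [y Gy sXQ] := Sylow_subJ unip_Sylow sXG px.
by exists y^-1; rewrite ?groupV // -mem_conjg (subsetP sXQ) ?cycle_id.
Qed.

Lemma expg_prime_order x p : prime p -> (p %| #[x])%N -> exists i, #[x ^+ i] = p.
Proof.
move=> pr_p /dvdnP[i e]; have i0 : (0 < i)%N.
  by have := order_gt0 x; rewrite e muln_gt0 => /andP[].
by exists i; rewrite orderXdiv e ?dvdn_mulr // mulKn.
Qed.

(** An element centralizes its powers; in this form the trivial intersection lemmas locate [x ^ y]
    from one of its powers. *)
Lemma conj_cent x y i : ((x ^+ i) ^ y) ^ (x ^ y) = (x ^+ i) ^ y.
Proof. by rewrite -conjJg [_ ^ x]conjgE -expgSr expgS mulKg. Qed.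

(** A power of [x] of order [p] is conjugate into the torus, which puts [x ^ y] into the torus
    normalizer. The elements [M l * T] there are involutions, while [p] is odd. *)
Lemma conj_torus_of_prime x p : x \in G -> prime p -> (p %| q.-1)%N ->
  (p %| #[x])%N -> exists y l, [/\ y \in G, l != 0%R & x ^ y = M l].
Proof.
move=> Gx pr_p p_q p_x; have [op _] := torus_prime pr_p p_q.
have [k ok] := expg_prime_order pr_p p_x.
have [|||y Gy Dxy] := @conj_torus G (x ^+ k) torus_sub (subxx _);
  rewrite ?ok ?groupX //.
have x1 : (x ^+ k) ^ y != 1 by rewrite -order_gt1 orderJ ok prime_gt1.
have /torus_normalizerP[l l0 [e|e]] : x ^ y \in N.
  by apply: (torus_TI Dxy x1); [apply: groupJ | rewrite conj_cent].
  by exists y, l.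
suff : (#[x] %| 2)%N.
  by move/(dvdn_trans p_x); rewrite dvdn_prime2 // => /eqP e2; rewrite e2 in op.
rewrite -(orderJ x y) order_dvdn e expgS expg1 mulgA -(mulgA (M l)).
by rewrite T_mulM // mulgA M_mul ?invr_eq0 // divff // M1 mul1g T_mul.
Qed.

Lemma conj_borel_of_even x : x \in G -> (2 %| #[x])%N ->
  exists2 y, y \in G & x ^ y \in B.
Proof.
move=> Gx x2; have [k ok] := expg_prime_order (isT : prime 2) x2.
have [||y Gy Qxy] := @conj_unip (x ^+ k); rewrite ?groupX // /p_elt ?ok //.
exists y => //; apply: (unip_TI Qxy); rewrite ?conj_cent //; last exact: groupJ.
by rewrite -order_gt1 orderJ ok.
Qed.

(** * Generation of the group *)

Lemma theta_onto a : exists l, th l = a.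
Proof. by have [g _ gK] := injF_bij (theta_inj hF (n := n)); exists (g a). Qed.

Lemma sqr_mul_theta_onto a : exists l, (l ^+ 2 * th l)%R = a.
Proof.
have inj : injective (fun l => l ^+ 2 * th l)%R.
  move=> l m; have [->|m0] := eqVneq m 0%R.
    rewrite theta0 mulr0 => /eqP; rewrite mulf_eq0 expf_eq0 theta_eq0 /=.
    by rewrite orbb => /eqP.
  have mm0 : (m ^+ 2 * th m)%R != 0%R by rewrite mulf_neq0 ?expf_neq0 ?theta_eq0.
  move=> e; apply: (mulIf (invr_neq0 m0)); rewrite mulfV //; apply/eqP.
  rewrite -(sqr_mul_theta_eq1 hF) thetaM thetaV exprMn exprVn mulrACA -invfM e.
  by rewrite mulfV.
by have [g _ gK] := injF_bij inj; exists (g a); apply: gK.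
Qed.

(** The case [a = 0], [b = 1] of [rel_T_S_T]. It shows that [T] is conjugate to [S 0 1]. *)
Lemma T_S01_T : T * S 0 1 * T = S 1 0 * T * (S 1 0)^-1.
Proof.
have f1 : ovoid n (0 : F)%R (1 : F)%R = 1%R.
  by rewrite /ovoid theta0 theta1 !mulr0 mul0r !add0r.
have := @T_S_T 0%R 1%R; rewrite f1 theta0 theta1 mulr0 addr0 !divr1 oner_eq0 M1.
by move=> /(_ isT) e; rewrite -(mulg1 (S 1 0 * T)) -e mulgK.
Qed.

(* Let [R a c] say that [H] contains [S(a, _) T S(c, _)].  From [R 1 1] the torus
   yields [R a a^-1] for all [a != 0], and multiplying the elements for [R 1 1]
   and [R mu mu^-1] yields [R al^2 (al^-1 + mu^-1)] with [al = 1 + mu].  Comparing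
   with [R al^2 al^-2] gives an element of [H] in [Q] but not in its center. *)
Lemma Z_torus_T_generate (H : {group gT}) :
  (forall b, S 0 b \in H) -> D \subset H -> T \in H -> G \subset H.
Proof.
move=> HZ HD HT; have HM l : l != 0%R -> M l \in H.
  by move=> l0; rewrite (subsetP HD) ?mem_M.
(* As [H] contains all [S 0 b], the second arguments at both ends of a word do not affect membership
   in [H]. *)
have wl a b g : (S a b * g \in H) = (S a 0 * g \in H).
  have -> : S a b = S 0 b * S a 0 by rewrite S_mul theta0 mul0r !addr0 add0r.
  by rewrite -mulgA (groupMl _ (HZ b)).
have wr a b g : (g * S a b \in H) = (g * S a 0 \in H).
  have -> : S a b = S a 0 * S 0 b by rewrite S_mul mulr0 !addr0 add0r.
  by rewrite mulgA (groupMr _ (HZ b)).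
pose R a c := S a 0 * T * S c 0 \in H.
have R11 : R 1%R 1%R.
  have : T * S 0 1 * T \in H by rewrite !groupM.
  by rewrite T_S01_T S_inv wr.
have RJ a c l : l != 0%R -> R a c -> R ((th l)^-1 * a)%R (th l * c)%R.
  move=> l0 Rac; have : M l * (S a 0 * T * S c 0) * M l \in H.
    by rewrite groupM ?HM // groupM ?HM.
  have MTM : M l * T * M l = T.
    by rewrite M_mulT // -mulgA M_mul ?invr_eq0 // mulVf // M1 mulg1.
  rewrite !mulgA M_mulS // -(mulgA _ (S c 0)) (S_mulM c 0%R l0) !mulgA.
  rewrite -(mulgA _ (M l) T) -(mulgA _ (M l * T) (M l)) MTM.
  by rewrite wr -mulgA wl mulgA.
have RR a b c d e f : S a b * T * S c d \in H -> S a e * T * S c f \in H.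
  by rewrite -!mulgA !(wl a) !mulgA !(wr c).
have [mu mu0 mu1] : exists2 mu : F, mu != 0%R & mu != 1%R.
  have : (0 < #|~: [set (0 : F)%R; 1%R]|)%N.
    rewrite -(ltn_add2l #|[set (0 : F)%R; 1%R]|) cardsC cards2 addn0.
    by apply: leq_trans q_ge8; case: (_ != _).
  by case/card_gt0P=> mu; rewrite !inE negb_or => /andP[]; exists mu.
pose al := (1 + mu)%R; have al0 : al != 0%R by rewrite (add_eq0 hF) eq_sym.
pose f := ovoid n al 0%R.
have ef : f = (al ^+ 2 * th al)%R by rewrite /f /ovoid theta0 mulr0 !addr0.
have tal0 : th al != 0%R by rewrite theta_eq0.
have f0 : f != 0%R by rewrite ef mulf_neq0 ?expf_neq0.
have etf : th f = (th al ^+ 2 * al ^+ 2)%R by rewrite ef thetaM thetaX (thetaK hF).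
have tf0 : th f != 0%R by rewrite theta_eq0.
have Rmu : R mu mu^-1%R.
  have [l el] := theta_onto mu^-1%R.
  have l0 : l != 0%R by rewrite -(theta_eq0 n) el invr_eq0.
  by have := RJ _ _ _ l0 R11; rewrite el invrK !mulr1.
have Ral : R (al ^+ 2)%R (al ^- 2)%R.
  have [l el] := theta_onto (al ^- 2)%R.
  have l0 : l != 0%R by rewrite -(theta_eq0 n) el invr_eq0 expf_neq0.
  by have := RJ _ _ _ l0 R11; rewrite el invrK !mulr1.
have Rprod : R (al ^+ 2)%R (al^-1 + mu^-1)%R.
  (* The second argument [mu] makes [S 1 0 * S mu mu] equal to [S al 0]. *)
  have : S 1 0 * T * S 1 0 * (S mu mu * T * S mu^-1 0) \in H.
    by rewrite groupM //; apply: (RR mu 0%R mu^-1%R 0%R).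
  have -> : S 1 0 * T * S 1 0 * (S mu mu * T * S mu^-1 0) =
            S 1 0 * (T * S al 0 * T) * S mu^-1 0.
    rewrite -!mulgA (mulgA (S 1 0) (S mu mu)) S_mul theta1 mul1r add0r (addxx hF).
    by rewrite !mulgA.
  have k0 : (f / th f)%R != 0%R by rewrite mulf_neq0 ?invr_eq0.
  have /(canRL (mulgK _)) -> := T_S_T f0; rewrite -/f S_inv -(mulgA _ T) T_mulM //.
  rewrite !mulgA S_mul S_mulM ?invr_eq0 // -!mulgA groupMl ?HM ?invr_eq0 //.
  rewrite S_mul wl !mulgA wr.
  congr (S _ _ * _ * S _ _ \in H).
    rewrite thetaV thetaM thetaV (thetaK hF) etf ef mul0r addr0 mulr1.
    by field; rewrite ?oner_eq0 ?al0 ?tal0.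
  by rewrite ef add0r; congr (_ + _)%R; field; rewrite ?oner_eq0 ?al0 ?tal0.
have [e [b [e0 HS]]] : exists e b, e != 0%R /\ S e b \in H.
  have := groupM (groupVr Ral) Rprod.
  rewrite invMg -mulgA mulKg S_inv S_mul => He; do 2!eexists; split; last exact: He.
  (* Over the denominator [al^2 mu] the numerator is [mu + al mu + al^2], which is 1 because
     [al = 1 + mu]. *)
  have -> : (al ^- 2 + (al^-1 + mu^-1) = (al ^+ 2 * mu)^-1)%R.
    by rewrite /al; char2_field hF; rewrite mu0 al0.
  by rewrite invr_eq0 mulf_neq0 ?expf_neq0.
have HQ : Q \subset H.
  apply/subsetP=> _ /unipP[a [d ->]].
  rewrite -(mulg1 (S a d)) wl mulg1; have [->|a0] := eqVneq a 0%R; first exact: HZ.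
  have [l el] := theta_onto (a / e)%R.
  have l0 : l != 0%R by rewrite -(theta_eq0 n) el mulf_neq0 ?invr_eq0.
  have : S e b * M l \in H by rewrite groupM ?HM.
  rewrite S_mulM // groupMl ?HM // el divfK //.
  by rewrite -(mulg1 (S _ _)) wl mulg1.
by rewrite defG gen_subG !subUset HQ HD sub1set HT.
Qed.

(** Either [x] or its square is some [S 0 b] with [b != 0]. The torus scales [b] by [l^2 theta(l)],
    which takes every value, so [H] contains all [S 0 c]. *)
Lemma unip_torus_T_generate (H : {group gT}) x :
  D \subset H -> T \in H -> x \in H -> x \in Q -> x != 1 -> G \subset H.
Proof.
move=> HD HT Hx Qx x1; apply: Z_torus_T_generate => //.
have [b b0 Hb] : exists2 b, b != 0%R & S 0 b \in H.
  case/unipP: Qx Hx x1 => a [b ->] Hx x1; have [a0|a0] := eqVneq a 0%R.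
    exists b; last by rewrite -a0.
    by apply: contraNneq x1 => b0; rewrite a0 b0 S00.
  exists (th a * a)%R; first by rewrite mulf_neq0 ?theta_eq0.
  by have := groupM Hx Hx; rewrite S_mul !(addxx hF) add0r.
move=> c; have [->|c0] := eqVneq c 0%R; first by rewrite S00.
have [l el] := sqr_mul_theta_onto (c / b)%R.
have l0 : l != 0%R.
  apply: contraNneq (mulf_neq0 c0 (invr_neq0 b0)) => l0.
  by rewrite -el l0 theta0 mulr0.
have HM : M l \in H by rewrite (subsetP HD) ?mem_M.
have : S 0 b * M l \in H by rewrite groupM.
by rewrite S_mulM // groupMl // el divfK // mulr0.
Qed.

Lemma torus_normalizer_norm x g : g \in N -> (x ^ g \in D) = (x \in D).
Proof.
move=> Ng; apply: memJ_norm; move: g Ng; apply/subsetP.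
by rewrite join_subG normG cycle_subG T_norm_torus.
Qed.

(* If [H] meets [Q] trivially, no element of odd order of [H] fixes the point of
   a Sylow 2-subgroup [E] of [H]: it would be conjugate in [H] into the torus,
   and [E] into [Q]. *)
Lemma torus_T_generate (H : {group gT}) :
  H \subset G -> D \subset H -> T \in H -> (4 %| #|H|)%N -> G \subset H.
Proof.
move=> sHG HD HT H4; have q7 : (7 <= q.-1)%N by have := q_ge8; clear; lia.
have [x /and3P[Hx Qx x1]|noHQ] := pickP [pred x | [&& x \in H, x \in Q & x != 1]].
  by apply: (@unip_torus_T_generate H x).
exfalso; have HQ1 x : x \in H -> x \in Q -> x = 1.
  by move=> Hx Qx; apply/eqP; have := noHQ x; rewrite /= Hx Qx => /negbFE.
have sNH : N \subset H by rewrite join_subG HD cycle_subG.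
have [E sylE] := Sylow_exists 2 H; have sEH := pHall_sub sylE.
have [g Gg sEQ] := Sylow_subJ unip_Sylow (subset_trans sEH sHG) (pHall_pgroup sylE).
have E4 : (4 <= #|E|)%N.
  apply: dvdn_leq => //; rewrite (card_Hall sylE).
  by rewrite -(part_pnat_id (isT : 2.-nat 4)%N) partn_dvd.
have EE : (H :&: B :^ g)%G = E :> {set gT}.
  have sEK : E \subset H :&: B :^ g.
    by rewrite subsetI sEH (subset_trans sEQ) // conjSg unip_sub_borel.
  apply: (sub_pHall sylE) => //; last exact: subsetIl.
  apply/pgroupP=> p pr_p p_dv; rewrite inE; apply/negPn/negP=> p2.
  have p_q : (p %| q.-1)%N.
    have := dvdn_trans p_dv (cardSg (subsetIr H (B :^ g))).
    rewrite cardJg card_borel Euclid_dvdM // Euclid_dvdX // hF Euclid_dvdX //.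
    by rewrite dvdn_prime2 // (negPf p2).
  have [x Kx ox] := Cauchy pr_p p_dv; have [Hx Bx] := setIP Kx.
  have [|||||y Hy Dxy] := @conj_torus H x; rewrite ?ox //.
  have [|||||z Bz Dxz] := @conj_torus borel (x ^ g^-1); rewrite ?orderJ ?ox //.
  - exact: torus_sub_borel.
  - exact: borel_sub.
  - by rewrite -mem_conjg.
  have [Gz Gy] := (subsetP borel_sub z Bz, subsetP sHG y Hy).
  (* [x] is conjugate into [D] by [y] in [H] and by [g^-1 z]; the element [z^-1 g y] linking these
     two conjugates normalizes [D], so it lies in [H]. *)
  have Nw : z^-1 * g * y \in N.
    apply: (torus_TI Dxz).
    - by rewrite -order_gt1 !orderJ ox prime_gt1.
    - by rewrite !groupM ?groupV ?Gz ?Gy ?Gg.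
    - by rewrite -!conjgM -!mulgA mulKVg mulKg.
  have E1 : E :=: 1.
    (* Conjugation by [y w^-1 = g^-1 z] keeps [u] in [H] by the first expression and sends it into
       [Q] by the second. *)
    apply/trivgP/subsetP=> u Eu; rewrite inE.
    pose w := z^-1 * g * y; have Hw : w \in H by rewrite (subsetP sNH).
    suff /eqP : u ^ (y * w^-1) = 1 by rewrite conjg_eq1.
    apply: HQ1.
      by apply: groupJ; [apply: (subsetP sEH) | rewrite groupM ?groupV].
    have -> : y * w^-1 = g^-1 * z by rewrite /w !invMg invgK !mulgA mulgV mul1g.
    rewrite conjgM memJ_norm ?(subsetP (normal_norm unip_normal)) //.
    by rewrite -mem_conjg (subsetP sEQ).
  by rewrite E1 cards1 in E4.
have TI1 : normedTI E^# H E.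
  apply/normedTI_memJ_P; split=> //.
    by rewrite setD_eq0 subG1 -cardG_gt1 (leq_trans _ E4).
  move=> a h /setD1P[a1 Ea] Hh; rewrite !inE conjg_eq1 a1 /=.
  apply/idP/idP=> [Eah|Eh]; last by rewrite groupJ.
  rewrite -EE inE Hh mem_conjg.
  apply: (@unip_TI (a ^ g^-1)); rewrite ?conjg_eq1 //.
  - by rewrite -mem_conjg (subsetP sEQ).
  - by rewrite groupJ ?groupV // (subsetP sHG).
  - by rewrite -conjJg -mem_conjg (subsetP sEQ).
have TI2 : normedTI D^# H N.
  apply/normedTI_memJ_P; split=> //.
    by rewrite setD_eq0 (subG1 torus_group) -cardG_gt1 card_torus (leq_trans _ q7).
  move=> a h /setD1P[a1 Da] Hh; rewrite !inE conjg_eq1 a1 /=.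
  apply/idP/idP=> [Dah|Nh]; last by rewrite torus_normalizer_norm.
  by apply: (torus_TI Da a1) => //; apply: (subsetP sHG).
have C1 := card_support_normedTI TI1; have C2 := card_support_normedTI TI2.
have sub1 : class_support E^# H \subset H.
  by rewrite class_support_subG // (subset_trans (subsetDl _ _)).
have sub2 : class_support D^# H \subset H.
  by rewrite class_support_subG // (subset_trans (subsetDl _ _)).
(* Elements of the first set have order a power of 2, those of the second an order dividing the odd
   number [q - 1]. *)
have dis : class_support E^# H :&: class_support D^# H = set0.
  apply/setP=> x; rewrite !inE; apply/andP=> -[].
  case/imset2P=> a h /setD1P[a1 Ea] Hh ->.
  case/imset2P=> d k /setD1P[d1 Dd] Hk e.
  have od : #[d] = #[a] by rewrite -(orderJ a h) e orderJ.
  have o1 : 2.-nat #[d] by rewrite od; apply: (mem_p_elt (pHall_pgroup sylE) Ea).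
  have o2 : (#[d] %| q.-1)%N by rewrite -card_torus order_dvdG.
  have op2 : odd #[d].
    apply: (dvdn_odd o2).
    by have := q_even; have := q_gt1; case: q => // i _ /=; rewrite negbK.
  have : #[d] = 1%N by apply: (pnat_1 o1); rewrite p'natE // dvdn2 op2.
  by move/eqP; rewrite order_eq1 (negPf d1).
have := subset_leq_card (introT subUsetP (conj sub1 sub2)).
rewrite cardsU dis cards0 subn0 C1 C2.
have eE := Lagrange sEH; have eN := Lagrange sNH; rewrite card_torus_normalizer in eN.
have cE := cardsD1 1 E; have cD := cardsD1 1 D.
rewrite group1 add1n in cE; rewrite (group1 torus_group) card_torus add1n in cD.
have jN : (0 < #|H : N|)%N by rewrite indexg_gt0.
(* In the names introduced next, [h = (c + 1) i = 2 (d + 1) j] and [c i + d j <= h]. Hence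
   [d j <= i] and [4 d j <= 4 i <= h = 2 (d + 1) j], impossible for [d >= 6]. *)
move: eE eN cE cD jN E4; move: #|H : E| #|H : N| #|E^#| #|D^#| #|E| #|H|.
move=> i j c d e h eE eN ec ed j0 e4 le; rewrite ed in eN; rewrite ec in eE e4.
have d6 : (6 <= d)%N by rewrite -ltnS -ed.
have dj : (d * j <= i)%N by move: le; rewrite -eE mulSn addnC leq_add2r.
have i4 : (4 * i <= c.+1 * i)%N by rewrite leq_mul2r e4 orbT.
have j6 : (6 * j <= d * j)%N by rewrite leq_mul2r d6 orbT.
move: eE eN i4 j6 dj j0; clear; lia.
Qed.

Lemma sqr_onto l : exists m, (m ^+ 2)%R = l.
Proof.
have [k ek] := theta_onto l; have [m em] := theta_onto k.
by exists m; rewrite -(thetaK hF) em ek.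
Qed.

(** [s] inverts both generators of the subgroup, hence normalizes it, and together with it generates
    [G]. *)
Lemma involution_triple_generate (r s t : gT) :
  r * r = 1 -> s * s = 1 -> t * t = 1 -> G :=: <<[set r; s; t]>> ->
  <<[set r * s; s * t]>> = G.
Proof.
move=> r2 s2 t2 genG; set H := <<_>>.
have [Hab Hbc] : r * s \in H /\ s * t \in H.
  by split; apply: mem_gen; rewrite !inE eqxx ?orbT.
have nHb : s \in 'N(H).
  have conjb x y : x * x = 1 -> y * y = 1 -> x * y \in H ->
      s * (x * y) * s = y * x -> (x * y) ^ s \in H.
    move=> x2 y2 Hxy e; rewrite conjgE (_ : s^-1 = s); last first.
      by apply/eqP; rewrite eq_invg_mul s2.
    rewrite mulgA e (_ : y * x = (x * y)^-1) ?groupV // invMg.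
    by congr (_ * _); apply/eqP; rewrite eq_sym eq_invg_mul ?x2 ?y2.
  rewrite inE -genJ gen_subG; apply/subsetP=> _ /imsetP[x x_in ->].
  move: x_in; rewrite !inE => /orP[]/eqP->; apply: conjb => //.
    by rewrite -!mulgA s2 mulg1.
  by rewrite !mulgA s2 mul1g.
have sGH : G \subset H <*> <[s]>.
  have Hb : s \in H <*> <[s]> by rewrite mem_gen // inE cycle_id orbT.
  have sH := subsetP (joing_subl H <[s]>).
  rewrite genG gen_subG; apply/subsetP=> x; rewrite !inE => /orP[/orP[]|]/eqP->.
  - by rewrite -(mulg1 r) -s2 mulgA groupM // sH.
  - exact: Hb.
  - by rewrite -(mul1g t) -s2 -mulgA groupM // sH.
have sHG : H \subset G.
  rewrite gen_subG genG; apply/subsetP=> x; rewrite !inE => /orP[]/eqP->;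
  by rewrite groupM // mem_gen // !inE eqxx ?orbT.
have nHG : G \subset 'N(H).
  by rewrite (subset_trans sGH) // join_subG normG cycle_subG.
have sqrH x : x \in G -> x * x \in H.
  move/(subsetP sGH); rewrite norm_joinEr ?cycle_subG //.
  case/mulsgP=> h z Hh Bz ->; have z2 : z * z = 1.
    by case/cycleP: Bz => i ->; rewrite -expgMn // s2 expg1n.
  have nz : z \in 'N(H) by apply: (subsetP _ z Bz); rewrite cycle_subG.
  rewrite mulgA -(mulgA h) (_ : z * h = h ^ z^-1 * z).
    rewrite -mulgA -(mulgA (h ^ z^-1)) z2 mulg1.
    by apply: groupM => //; rewrite memJ_norm ?groupV.
  by rewrite conjgE invgK -!mulgA mulVg mulg1.
apply/eqP; rewrite eqEsubset sHG /=.
(* [S 0 1] is the square of [S 1 0], every torus element is a square, and [T] is a conjugate of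
   [S 0 1]; normality puts it into [H] too. *)
have H01 : S 0 1 \in H.
  have := sqrH _ (subsetP unip_sub _ (mem_S 1%R 0%R)).
  by rewrite S_mul (addxx hF) theta1 !mulr1 !add0r.
apply: (@unip_torus_T_generate (Group (groupP H)) (S 0 1)) => //; rewrite ?mem_S //.
- apply/subsetP=> _ /torusP[l l0 ->]; have [m em] := sqr_onto l.
  have m0 : m != 0%R by apply: contraNneq l0 => m0; rewrite -em m0 expr0n.
  by rewrite -em expr2 -M_mul // sqrH // (subsetP torus_sub) ?mem_M.
- have -> : T = S 0 1 ^ (T * S 1 0).
    by rewrite conjgM conjT T_S01_T conjgE !mulgA mulVg mul1g mulgKV.
  rewrite memJ_norm //; apply: (subsetP nHG).
  by rewrite groupM ?mem_T // (subsetP unip_sub) ?mem_S.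
apply/eqP=> e; have [|_ e1] := @S_inj 0%R 1%R 0%R 0%R; rewrite ?S00 //.
by have := oner_eq0 F; rewrite e1 eqxx.
Qed.

(** For [l != 0] this says that [l] generates the multiplicative group. It holds for 0 as well,
    whence the separate condition [l != 0] in its uses. *)
Definition primitive_elt l := forall i, (l ^+ i)%R = 1%R -> (q.-1 %| i)%N.

Lemma M_exp l i : l != 0%R -> M l ^+ i = M (l ^+ i)%R.
Proof.
move=> l0; elim: i => [|i IH]; first by rewrite expr0 M1.
by rewrite expgS IH M_mul ?expf_neq0 // exprS.
Qed.

Lemma expf_q1 l : l != 0%R -> (l ^+ q.-1)%R = 1%R.
Proof.
move=> l0; apply: (mulfI l0); rewrite -exprS prednK ?expf_card ?mulr1 //.
exact: ltnW q_gt1.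
Qed.

Lemma order_M l : l != 0%R -> primitive_elt l -> #[M l] = q.-1.
Proof.
move=> l0 prim_l; apply/eqP; rewrite eqn_dvd order_dvdn M_exp // expf_q1 // M1 eqxx.
by apply: prim_l; apply: M_inj; rewrite ?expf_neq0 ?oner_eq0 // -M_exp // expg_order M1.
Qed.

Lemma torus_cycle l : l != 0%R -> primitive_elt l -> <[M l]> = D.
Proof.
move=> l0 prim_l; apply/eqP.
rewrite eqEcard cycle_subG mem_M // card_torus -orderE order_M //=.
Qed.

Lemma dvd4_klein (H : {group gT}) x y : x \in H -> y \in H -> x * x = 1 ->
  y * y = 1 -> x * y = y * x -> x != 1 -> y != 1 -> x != y -> (4 %| #|H|)%N.
Proof.
move=> Hx Hy x2 y2 cxy x1 y1 xy.
have ox : #[x] = 2 by apply: nt_prime_order => //; rewrite expgS expg1.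
have oy : #[y] = 2 by apply: nt_prime_order => //; rewrite expgS expg1.
have sub : <[x]> <*> <[y]> \subset H by rewrite join_subG !cycle_subG Hx Hy.
suff e : #|<[x]> <*> <[y]>| = 4 by rewrite -e cardSg.
rewrite cent_joinEr; last by apply: cents_cycle.
rewrite TI_cardMg -?orderE ?ox ?oy //; apply/trivgP/subsetP=> z.
rewrite inE /= (cycle2g ox) (cycle2g oy) !inE => /andP[/orP[/eqP->|/eqP->]].
  by rewrite eqxx.
by rewrite (negPf x1) (negPf xy).
Qed.

End Relations.

(** * The Suzuki group *)

Section SuzukiMatrices.
Local Open Scope ring_scope.
Variables (n : nat) (F : finFieldType).
Hypothesis hF : #|F| = (2 ^ (2 * n + 1))%N.
Hypothesis n_gt0 : (0 < n)%N.
Local Notation th := (@suzuki_theta n F).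
Local Notation q := #|F|.

(* Typing every element in one fixed instance keeps the products of matrices
   syntactically equal to those of the abstract lemmas. *)
Definition gl4 : finGroupType := {'GL_4[F]}.

Local Notation G := (suzuki_group n F : {group gl4}).
Implicit Types a b c d k l m s t x y z : F.
Let thetaE := (thetaD hF, thetaM, thetaV, thetaX, thetaK hF, @theta0, @theta1).

(** * The generating matrices and their products *)

Lemma mx4_of_rowsM
    a00 a01 a02 a03 a10 a11 a12 a13 a20 a21 a22 a23 a30 a31 a32 a33
    b00 b01 b02 b03 b10 b11 b12 b13 b20 b21 b22 b23 b30 b31 b32 b33 :
  mx4_of_rows [:: [:: a00; a01; a02; a03]; [:: a10; a11; a12; a13];
                  [:: a20; a21; a22; a23]; [:: a30; a31; a32; a33]] *m
  mx4_of_rows [:: [:: b00; b01; b02; b03]; [:: b10; b11; b12; b13];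
                  [:: b20; b21; b22; b23]; [:: b30; b31; b32; b33]] =
  mx4_of_rows
   [:: [:: a00 * b00 + a01 * b10 + a02 * b20 + a03 * b30;
           a00 * b01 + a01 * b11 + a02 * b21 + a03 * b31;
           a00 * b02 + a01 * b12 + a02 * b22 + a03 * b32;
           a00 * b03 + a01 * b13 + a02 * b23 + a03 * b33];
       [:: a10 * b00 + a11 * b10 + a12 * b20 + a13 * b30;
           a10 * b01 + a11 * b11 + a12 * b21 + a13 * b31;
           a10 * b02 + a11 * b12 + a12 * b22 + a13 * b32;
           a10 * b03 + a11 * b13 + a12 * b23 + a13 * b33];
       [:: a20 * b00 + a21 * b10 + a22 * b20 + a23 * b30;
           a20 * b01 + a21 * b11 + a22 * b21 + a23 * b31;
           a20 * b02 + a21 * b12 + a22 * b22 + a23 * b32;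
           a20 * b03 + a21 * b13 + a22 * b23 + a23 * b33];
       [:: a30 * b00 + a31 * b10 + a32 * b20 + a33 * b30;
           a30 * b01 + a31 * b11 + a32 * b21 + a33 * b31;
           a30 * b02 + a31 * b12 + a32 * b22 + a33 * b32;
           a30 * b03 + a31 * b13 + a32 * b23 + a33 * b33]] :> 'M[F]_4.
Proof.
apply/matrixP=> i j; rewrite !mxE !big_ord_recr big_ord0 /= add0r !mxE.
by case: i => [[|[|[|[|//]]]] ?]; case: j => [[|[|[|[|//]]]] ?].
Qed.

Lemma mx4_of_rows_scalar t :
  t%:M = mx4_of_rows [:: [:: t; 0; 0; 0]; [:: 0; t; 0; 0];
                         [:: 0; 0; t; 0]; [:: 0; 0; 0; t]] :> 'M[F]_4.
Proof.
apply/matrixP=> i j; rewrite !mxE.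
by case: i => [[|[|[|[|//]]]] ?]; case: j => [[|[|[|[|//]]]] ?].
Qed.

Lemma GLval_inj : injective (@GLval 4 F).
Proof. exact: val_inj. Qed.

Lemma val_gl_mul (x y : gl4) : GLval (x * y)%g = GLval x *m GLval y.
Proof. exact: GL_MxE. Qed.

Lemma val_gl1 : GLval (1%g : gl4) = 1%:M.
Proof. by []. Qed.

(** [insubd] returns the identity on a singular matrix. The lemmas on [GLval] below rule this case
    out, for [glM] under [l != 0]. *)
Definition glS a b : gl4 := insubd (1%g : {'GL_4[F]}) (suzuki_S n a b).
Definition glM l : gl4 := insubd (1%g : {'GL_4[F]}) (suzuki_M n l).
Definition glT : gl4 := insubd (1%g : {'GL_4[F]}) (suzuki_T F).

Arguments glS (a b)%_R.
Arguments glM l%_R.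

Lemma val_glS a b : GLval (glS a b) = suzuki_S n a b.
Proof.
apply: insubdK; suff: suzuki_S n a b *m suzuki_S n a (b + a * th a) = 1%:M.
  by case/mulmx1_unit.
rewrite (mx4_of_rows_scalar 1) mx4_of_rowsM; do ![congr cons | congr mx4_of_rows];
  by rewrite ?thetaE //; char2_ring hF.
Qed.

Lemma val_glM l : l != 0 -> GLval (glM l) = suzuki_M n l.
Proof.
move=> l0; apply: insubdK; suff: suzuki_M n l *m suzuki_M n l^-1 = 1%:M.
  by case/mulmx1_unit.
have t0 : th l != 0 by rewrite theta_eq0.
rewrite (mx4_of_rows_scalar 1) mx4_of_rowsM; do ![congr cons | congr mx4_of_rows];
  by rewrite ?thetaE ?invrK //; field; rewrite ?oner_eq0 ?l0 ?t0.
Qed.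

Lemma val_glT : GLval glT = suzuki_T F.
Proof.
apply: insubdK; suff: suzuki_T F *m suzuki_T F = 1%:M by case/mulmx1_unit.
rewrite (mx4_of_rows_scalar 1) mx4_of_rowsM.
by do ![congr cons | congr mx4_of_rows]; ring.
Qed.

Lemma glT_mul : (glT * glT = 1)%g.
Proof.
apply: GLval_inj; rewrite !val_gl_mul val_glT.
rewrite [LHS]mx4_of_rowsM; apply: etrans (esym (mx4_of_rows_scalar 1)).
do ![congr cons | congr mx4_of_rows]; ring.
Qed.

Lemma glS_mul a b c d : (glS a b * glS c d = glS (a + c) (b + d + th a * c))%g.
Proof.
apply: GLval_inj; rewrite !val_gl_mul !val_glS [LHS]mx4_of_rowsM.
do ![congr cons | congr mx4_of_rows];
  by rewrite ?thetaE //; char2_ring hF.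
Qed.

Lemma glM_mul l m : l != 0 -> m != 0 -> (glM l * glM m = glM (l * m))%g.
Proof.
move=> l0 m0; apply: GLval_inj; rewrite !val_gl_mul !val_glM ?mulf_neq0 //.
have tl0 : th l != 0 by rewrite theta_eq0.
have tm0 : th m != 0 by rewrite theta_eq0.
rewrite [LHS]mx4_of_rowsM; do ![congr cons | congr mx4_of_rows];
  by rewrite ?thetaE //; field; rewrite ?oner_eq0 ?l0 ?m0 ?tl0 ?tm0.
Qed.

Lemma glS_mulM a b l : l != 0 ->
  (glS a b * glM l = glM l * glS (th l * a) (l ^+ 2 * th l * b))%g.
Proof.
move=> l0; apply: GLval_inj; rewrite !val_gl_mul !val_glM // !val_glS.
have t0 : th l != 0 by rewrite theta_eq0.
rewrite [LHS]mx4_of_rowsM [RHS]mx4_of_rowsM.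
by do ![congr cons | congr mx4_of_rows];
   rewrite ?thetaE //; field; rewrite ?oner_eq0 ?l0 ?t0.
Qed.

Lemma glM_mulT l : l != 0 -> (glM l * glT = glT * glM l^-1)%g.
Proof.
move=> l0; apply: GLval_inj; rewrite !val_gl_mul !val_glM ?invr_eq0 // !val_glT.
have t0 : th l != 0 by rewrite theta_eq0.
rewrite [LHS]mx4_of_rowsM [RHS]mx4_of_rowsM.
by do ![congr cons | congr mx4_of_rows];
   rewrite ?thetaE //; field; rewrite ?oner_eq0 ?l0 ?t0.
Qed.

Lemma bruhat a b : ovoid n a b != 0 ->
  (glT * glS a b * glT * glS ((b + a * th a) / ovoid n a b) (a / ovoid n a b) =
   glS (b / ovoid n a b) (a / ovoid n a b) * glT *
   glM (ovoid n a b / th (ovoid n a b)))%g.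
Proof.
move=> f0; have tf0 : th (ovoid n a b) != 0 by rewrite theta_eq0.
apply: GLval_inj; rewrite !val_gl_mul !val_glS !val_glT !val_glM ?mulf_neq0 ?invr_eq0 //.
(* Once [theta b] and [theta] of the ovoid value are expressed through [a], [b], [theta a] and the
   ovoid value, the entries agree as rational functions of independent variables. *)
have eB : th b = ovoid n a b + a ^+ 2 * th a + a * b by rewrite /ovoid; char2_ring hF.
have eg : th (ovoid n a b) = th a * ovoid n a b + a * b * th a + b ^+ 2.
  by rewrite /ovoid !thetaE; char2_ring hF.
rewrite /suzuki_S /suzuki_M -/(ovoid n a b).
move: (ovoid n a b) f0 tf0 eB eg => f f0 tf0 eB eg; rewrite !thetaE {}eB.
move: (th a) (th f) tf0 eg => A g g0 eg.
do 4!rewrite mx4_of_rowsM ?(mul0r, mulr0, mul1r, mulr1, add0r, addr0).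
rewrite mx4_of_rowsM !(mul0r, mulr0, mul1r, mulr1, add0r, addr0).
by do ![congr cons | congr mx4_of_rows] => //; rewrite ?eg; char2_field hF;
   rewrite -?eg ?oner_eq0 ?f0 ?g0.
Qed.

(* [S(1, 1) T] moves the fixed point of the [S(0, b)] to (1 : 1 : 1 : 1), the
   fixed point of [T]. *)
Definition glC b : gl4 :=
  (glS 1 1 * glT * glS 0 b * glT * glS 1 0)%g.
Arguments glC b%_R.

Definition mxC b c : 'M[F]_4 := mx4_of_rows
  [:: [:: 1 + c; b + c; b + c; c];
      [:: b + c; 1 + c; c; b + c];
      [:: b + c; c; 1 + c; b + c];
      [:: c; b + c; b + c; 1 + c]].

Lemma val_glC b : GLval (glC b) = mxC b (th b).
Proof.
rewrite !val_gl_mul !val_glS // !val_glT /suzuki_S /suzuki_T /mxC !thetaE.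
do 4!rewrite mx4_of_rowsM ?(mul0r, mulr0, mul1r, mulr1, add0r, addr0).
by do ![congr cons | congr mx4_of_rows] => //; char2_ring hF.
Qed.

Lemma glC_mul b c : (glC b * glC c = glC (b + c))%g.
Proof.
apply: GLval_inj; rewrite val_gl_mul !val_glC thetaD // /mxC mx4_of_rowsM.
by do ![congr cons | congr mx4_of_rows] => //; char2_ring hF.
Qed.

Lemma glC0 : (glC 0 = 1)%g.
Proof.
apply: GLval_inj; rewrite val_glC theta0 [RHS](mx4_of_rows_scalar 1).
by do ![congr cons | congr mx4_of_rows] => //; char2_ring hF.
Qed.

Lemma glC1 : glC 1 = glT.
Proof.
apply: GLval_inj; rewrite val_glC theta1 val_glT.
by do ![congr cons | congr mx4_of_rows] => //; char2_ring hF.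
Qed.

Lemma glC_inj : injective glC.
Proof.
move=> b c /(congr1 (@GLval 4 F)); rewrite !val_glC => /matrixP e.
by apply: (@theta_inj n _ hF); have := e ord0 ord_max; rewrite !mxE.
Qed.

(** * Products of the involutions [T M(l)] and [C(b)] *)

Definition trM l := l * th l + l + l^-1 + (l * th l)^-1.

Lemma glTM_invol l : l != 0 -> (glT * glM l * (glT * glM l) = 1)%g.
Proof.
move=> l0; rewrite -mulgA (mulgA (glM l)) glM_mulT // !mulgA glT_mul mul1g.
rewrite glM_mul ?invr_eq0 // mulVf //; apply: GLval_inj.
rewrite val_glM ?oner_eq0 // [RHS](mx4_of_rows_scalar 1).
by rewrite /suzuki_M !thetaE mulr1 invr1.
Qed.

Lemma gl_involg_mul (x y : gl4) :
  (x * x = 1 -> y * y = 1 -> (x * y)^-1 = y * x)%g.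
Proof.
move=> x2 y2; apply: (mulgI (x * y)%g); rewrite mulgV.
by rewrite -mulgA (mulgA y) y2 mul1g x2.
Qed.

Lemma glC_invol b : (glC b * glC b = 1)%g.
Proof. by rewrite glC_mul (addxx hF) glC0. Qed.

Lemma mx4_of_rowsD
    a00 a01 a02 a03 a10 a11 a12 a13 a20 a21 a22 a23 a30 a31 a32 a33
    b00 b01 b02 b03 b10 b11 b12 b13 b20 b21 b22 b23 b30 b31 b32 b33 :
  mx4_of_rows [:: [:: a00; a01; a02; a03]; [:: a10; a11; a12; a13];
                  [:: a20; a21; a22; a23]; [:: a30; a31; a32; a33]] +
  mx4_of_rows [:: [:: b00; b01; b02; b03]; [:: b10; b11; b12; b13];
                  [:: b20; b21; b22; b23]; [:: b30; b31; b32; b33]] =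
  mx4_of_rows
   [:: [:: a00 + b00; a01 + b01; a02 + b02; a03 + b03];
       [:: a10 + b10; a11 + b11; a12 + b12; a13 + b13];
       [:: a20 + b20; a21 + b21; a22 + b22; a23 + b23];
       [:: a30 + b30; a31 + b31; a32 + b32; a33 + b33]] :> 'M[F]_4.
Proof.
apply/matrixP=> i j; rewrite !mxE.
by case: i => [[|[|[|[|//]]]] ?]; case: j => [[|[|[|[|//]]]] ?].
Qed.

(* [W + W^-1] is a root of the quadratic polynomial through which the
   palindromic characteristic polynomial of [W = T M(l) C(b)] factors. *)
Lemma glTMC_quadratic l b (t := th b * trM l) (W := (glT * glM l * glC b)%g) :
  l != 0 ->
  let Y := GLval W + GLval W^-1 in Y *m Y + t%:M *m Y + (th t)%:M = 0.
Proof.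
move=> l0 Y; have t0 : th l != 0 by rewrite theta_eq0.
have eA : GLval (glT * glM l)%g = suzuki_T F *m suzuki_M n l.
  by rewrite val_gl_mul val_glT val_glM.
rewrite {}/Y {}/W; move: (glT * glM l)%g eA (glTM_invol l0) => A eA A2.
move: (glC b) (val_glC b) (glC_invol b) => C eC C2.
have -> : (A * C)^-1%g = (C * A)%g by apply: gl_involg_mul.
rewrite !val_gl_mul {}eA {}eC /suzuki_T /suzuki_M /mxC.
rewrite !(mx4_of_rowsM, mul0r, mulr0, mul1r, mulr1, add0r, addr0).
rewrite mx4_of_rowsD 2!mx4_of_rows_scalar !mx4_of_rowsM !mx4_of_rowsD.
rewrite /t /trM !thetaE !(mul0r, mulr0, mul1r, mulr1, add0r, addr0).
move: (th b) (th l) t0 => B m m0.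
have -> : 0 = 0%:M :> 'M[F]_4 by rewrite raddf0.
rewrite mx4_of_rows_scalar.
by do ![congr cons | congr mx4_of_rows] => //; char2_field hF;
   rewrite ?oner_eq0 ?l0 ?m0.
Qed.

(** * Borel matrices and verification of the Suzuki relations *)

Lemma val_glSM a b l : l != 0 -> GLval (glS a b * glM l)%g = mx4_of_rows
  [:: [:: l * th l; 0; 0; 0]; [:: a * (l * th l); l; 0; 0];
      [:: b * (l * th l); th a * l; l^-1; 0];
      [:: ovoid n a b * (l * th l); (a * th a + b) * l; a / l; (l * th l)^-1]].
Proof.
move=> l0; rewrite val_gl_mul val_glS // val_glM // [LHS]mx4_of_rowsM.
by rewrite !(mul0r, mulr0, mul1r, mulr1, add0r, addr0).
Qed.

Lemma glSM_eq1 a b l : l != 0 -> (glS a b * glM l = 1)%g -> [/\ a = 0, b = 0 & l = 1].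
Proof.
move=> l0 /(congr1 (@GLval 4 F)); rewrite val_glSM // => /matrixP e.
have ll0 : l * th l != 0 by rewrite mulf_neq0 ?theta_eq0.
have := e (inord 1) (inord 0); have := e (inord 2) (inord 0).
have := e (inord 1) (inord 1).
rewrite !mxE !inordK //= -!val_eqE /= !inordK //= => l1 /eqP + /eqP.
by rewrite !(mulIr_eq0 _ (mulIf ll0)) => /eqP-> /eqP->.
Qed.

Lemma glSM_neqT a b l : l != 0 -> (glS a b * glM l)%g <> glT.
Proof.
move=> l0 /(congr1 (@GLval 4 F)); rewrite val_glSM // val_glT.
move/matrixP/(_ (inord 0) (inord 3)); rewrite !mxE !inordK //= => /esym/eqP.
by rewrite oner_eq0.
Qed.

Lemma glTST_SM a b c d l : l != 0 ->
  (glT * glS a b * glT = glS c d * glM l)%g -> a = 0 /\ b = 0.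
Proof.
move=> l0 /(congr1 (@GLval 4 F)); rewrite val_glSM // !val_gl_mul val_glT val_glS //.
rewrite !mx4_of_rowsM !(mul0r, mulr0, mul1r, mulr1, add0r, addr0) => /matrixP e.
have := e (inord 0) (inord 1); have := e (inord 0) (inord 2).
rewrite !mxE !inordK //= => e1 a0; split=> //.
by move: e1; rewrite a0 mul0r add0r.
Qed.

Lemma suzuki_group_gen : G = <<[set glS p.1 p.2 | p : F * F]
  :|: [set glM l | l : F & l != 0%R] :|: [set glT]>>%g :> {set _}.
Proof.
congr generated; apply/setP=> g; rewrite !inE -orbA; congr [|| _, _ | _].
- apply/existsP/imsetP=> [[a /existsP[b /eqP e]]|[[a b] _ ->]].
    by exists (a, b) => //; apply: GLval_inj; rewrite e val_glS.
  by exists a; apply/existsP; exists b; rewrite val_glS.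
- apply/existsP/imsetP=> [[l /andP[l0 /eqP e]]|[l]].
    by exists l; rewrite ?inE //; apply: GLval_inj; rewrite e val_glM.
  by rewrite inE => l0 ->; exists l; rewrite val_glM // l0 eqxx.
by rewrite -val_glT; apply/eqP/eqP=> [/GLval_inj|->].
Qed.

Lemma suzuki_relP : @suzuki_relations n F _ G glS glM glT.
Proof.
split.
- exact: glS_mul.
- exact: glM_mul.
- exact: glS_mulM.
- exact: glM_mulT.
- exact: glT_mul.
- exact: bruhat.
- exact: glSM_eq1.
- exact: glSM_neqT.
- exact: glTST_SM.
exact: suzuki_group_gen.
Qed.

Let relG := suzuki_relP.

(** * Torus traces and elliptic field elements *)

Definition plus_inv x := x + x^-1.

Lemma trM_sum l : trM l = plus_inv (l * th l) + plus_inv l.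
Proof. by rewrite /trM /plus_inv; ring. Qed.

Lemma theta_trM l : l != 0 -> th (trM l) = plus_inv (l * th l) * plus_inv l.
Proof.
move=> l0; have t0 : th l != 0 by rewrite theta_eq0.
by rewrite /trM /plus_inv !thetaE; field; rewrite l0 t0.
Qed.

(** [trM l] and its image under [theta] are the sum and the product of two values of [plus_inv].
    Thus the quadratic polynomial attached to a torus trace splits over [F]. *)
Lemma trM_quadratic l s : l != 0 ->
  s ^+ 2 + trM l * s + th (trM l) = (s + plus_inv (l * th l)) * (s + plus_inv l).
Proof. by move=> l0; rewrite theta_trM // trM_sum; ring. Qed.

Lemma trM_sqr l : trM (l ^+ 2) = trM l ^+ 2.
Proof.
have sqD x y : (x + y) ^+ 2 = x ^+ 2 + y ^+ 2 by char2_ring hF.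
by rewrite /trM !thetaE !sqD exprMn !exprVn exprMn.
Qed.

Lemma plus_inv_inj x y : x != 0 -> y != 0 -> plus_inv x = plus_inv y ->
  x = y \/ x = y^-1.
Proof.
move=> x0 y0 e; have /eqP : (x + y) * (x * y + 1) = 0.
  have : x * y * (plus_inv x + plus_inv y) = 0 by rewrite e (addxx hF) mulr0.
  by move=> <-; rewrite /plus_inv; field; rewrite x0 y0.
rewrite mulf_eq0 !(add_eq0 hF) => /orP[]/eqP e2; [by left | right].
by rewrite -[RHS]mul1r -e2 mulfK.
Qed.

Lemma plus_inv_eq0 x : x != 0 -> (plus_inv x == 0) = (x == 1).
Proof.
move=> x0; rewrite (add_eq0 hF) -(inj_eq (mulfI x0)) divff // -expr2.
exact: (sqr_eq1 hF).
Qed.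

Lemma trM_eq0 l : l != 0 -> (trM l == 0) = (l == 1).
Proof.
move=> l0; rewrite trM_sum (add_eq0 hF); apply/eqP/eqP=> [|->]; last first.
  by rewrite theta1 mulr1.
have t0 : th l != 0 by rewrite theta_eq0.
case/plus_inv_inj; rewrite ?mulf_neq0 //.
  by move/eqP; rewrite -{3}(mulr1 l) (inj_eq (mulfI l0)) (theta_eq1 hF) => /eqP.
move=> e; apply/eqP; rewrite -(sqr_mul_theta_eq1 hF) expr2 -mulrA e.
by rewrite divff.
Qed.

(* If [trM l = 1], then [l + l^-1] is a root of [z^2 + z + 1]. *)
Lemma trM_neq1 l : l != 0 -> trM l != 1.
Proof.
move=> l0; apply/eqP=> e; have := trM_quadratic (plus_inv l) l0.
rewrite e theta1 mul1r (addxx hF) mulr0 => /eqP.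
by rewrite (negPf (no_cube_root hF _)).
Qed.

(* For [t != 0] this says that [y^2 + t y + theta t] has no root [y = t z]; as
   [0 / 0 = 0], the element [0] is not elliptic. *)
Definition elliptic t := [forall z, z ^+ 2 + z != th t / t ^+ 2].

Lemma ellipticN s t : elliptic t -> s ^+ 2 + t * s + th t != 0.
Proof.
move/forallP=> el; have [t0|t0] := eqVneq t 0.
  by have := el 0; rewrite t0 theta0 mul0r expr2 mul0r addr0 eqxx.
apply: contra (el (s / t)) => /eqP e.
rewrite -(add_eq0 hF); apply/eqP; rewrite -[RHS](mul0r (t ^- 2)) -e.
by field; rewrite t0.
Qed.

Lemma elliptic_neq0 t : elliptic t -> t != 0.
Proof.
move=> el; apply/eqP=> t0; have := ellipticN 0 el.
by rewrite t0 theta0 expr2 !mul0r !addr0 eqxx.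
Qed.

Lemma trM_not_elliptic l : l != 0 -> ~~ elliptic (trM l).
Proof.
move=> l0; apply/negP=> /(ellipticN (plus_inv l)).
by rewrite trM_quadratic // (addxx hF) mulr0 eqxx.
Qed.

(** For nonzero [s] and [t], equal values mean [theta(x) = x^2] with [x = s / t]; then
    [x^2 = theta(theta(x)) = x^4], so [x = 1]. Only 0 has value 0. *)
Lemma theta_div_sqr_inj : injective (fun t => th t / t ^+ 2).
Proof.
move=> s t /=; have [->|s0] := eqVneq s 0.
  rewrite theta0 mul0r => /esym/eqP; rewrite mulf_eq0 theta_eq0 invr_eq0.
  by rewrite expf_eq0 orbb => /eqP.
have [->|t0] := eqVneq t 0.
  rewrite theta0 mul0r => /eqP; rewrite mulf_eq0 theta_eq0 invr_eq0.
  by rewrite expf_eq0 orbb => /eqP.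
move=> e; apply: (mulIf (invr_neq0 t0)); rewrite divff //.
have : th (s / t) = (s / t) ^+ 2.
  rewrite thetaM thetaV; have t20 : th t != 0 by rewrite theta_eq0.
  apply: (mulIf (mulf_neq0 t20 (expf_neq0 2 (invr_neq0 s0)))).
  have -> : th s / th t * (th t * s^-1 ^+ 2) = th s / s ^+ 2.
    by field; rewrite s0 t20.
  by rewrite e; field; rewrite s0 t0.
move=> e2; have e3 := thetaK hF (s / t); rewrite e2 thetaX e2 in e3.
have st0 : (s / t) ^+ 2 != 0 by rewrite expf_neq0 // mulf_neq0 ?invr_eq0.
apply/eqP; rewrite -(sqr_eq1 hF) -(inj_eq (mulfI st0)) mulr1 -expr2.
by apply/eqP.
Qed.

(* The image [A] of [z |-> z^2 + z] does not contain 1, so it is disjoint from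
   its translate by 1 and has at most q/2 elements. *)
Lemma elliptic_sum t : t != 0 -> ~~ elliptic t ->
  exists u v, [/\ elliptic u, elliptic v & u + v = t].
Proof.
move=> t0 not_t; pose E := [set u | elliptic u].
pose A := [set z ^+ 2 + z | z : F].
have A2 : (2 * #|A| <= q)%N.
  have inj1 : injective (fun a => a + 1 : F) by apply: addIr.
  have dis : A :&: [set a + 1 | a in A] = set0.
    apply/setP=> x; rewrite !inE; apply/andP=> -[/imsetP[z _ ->]].
    case/imsetP=> _ /imsetP[w _ ->] e; have := no_cube_root hF (z + w).
    apply/negP/negPn; rewrite (add_eq0 hF); apply/eqP.
    have -> : (z + w) ^+ 2 + (z + w) = (z ^+ 2 + z) + (w ^+ 2 + w) by char2_ring hF.
    by rewrite e; char2_ring hF.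
  have := max_card (A :|: [set a + 1 | a in A]).
  by rewrite cardsU dis cards0 subn0 (card_imset _ inj1) mul2n addnn.
have CE : (#|~: E| <= #|A|)%N.
  rewrite -(card_imset (~: E) theta_div_sqr_inj); apply: subset_leq_card.
  apply/subsetP=> _ /imsetP[u nEu ->]; move: nEu.
  rewrite !inE negb_forall => /existsP[z]; rewrite negbK => /eqP<-.
  by apply/imsetP; exists z.
have [u /andP[Eu Etu]|none] := pickP [pred u | elliptic u & elliptic (u + t)].
  by exists u, (u + t); split; rewrite // addrA (addxx hF) add0r.
(* Without such a pair, the translate of [E] by [t] avoids [E]. The complement also contains 0,
   which is not in the translate because [t] is not elliptic; so [E] would have fewer than q/2
   elements and its complement at most q/2. *)
have : [set u + t | u in E] \proper ~: E.
  rewrite properE; apply/andP; split.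
    apply/subsetP=> _ /imsetP[u Eu ->]; rewrite !inE; rewrite inE in Eu.
    by have := none u; rewrite /= Eu /= => ->.
  apply/subsetPn; exists 0; first by rewrite !inE; apply/negP=> /elliptic_neq0/eqP.
  apply/imsetP=> -[u Eu] /esym/eqP; rewrite (add_eq0 hF) => /eqP ut.
  by rewrite inE ut (negPf not_t) in Eu.
move/proper_card; rewrite (card_imset _ (addIr t)).
move=> ltE; have : (#|E| + #|~: E| < 2 * #|A|)%N.
  by rewrite mul2n -addnn -addSn leq_add // (leq_trans ltE).
by rewrite cardsC ltnNge A2.
Qed.

(** * Eigenvalues and element orders *)

Definition quadratic_gl t (W : gl4) :=
  let Y := GLval W + GLval W^-1%g in Y *m Y + t%:M *m Y + (th t)%:M = 0.

Lemma mulmx_inv_gl (v : 'rV[F]_4) x (W : gl4) : x != 0 ->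
  v *m GLval W = x *: v -> v *m GLval W^-1%g = x^-1 *: v.
Proof.
move=> x0 e; apply: (scalerI x0); rewrite scalerA divff // scale1r.
have WV : GLval W *m GLval W^-1%g = 1%:M.
  by apply: etrans (esym (val_gl_mul W W^-1%g)) _; rewrite mulgV.
by rewrite scalemxAl -e -mulmxA WV mulmx1.
Qed.

Lemma quadratic_eigen t W (v : 'rV[F]_4) x : quadratic_gl t W -> v != 0 ->
  x != 0 -> v *m GLval W = x *: v -> plus_inv x ^+ 2 + t * plus_inv x + th t = 0.
Proof.
move=> quadW v0 x0 e; have eV := mulmx_inv_gl x0 e.
have eY : v *m (GLval W + GLval W^-1%g) = plus_inv x *: v.
  by rewrite mulmxDr e eV -scalerDl.
move: quadW; rewrite /quadratic_gl; move: (_ + GLval W^-1%g) eY => Y eY.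
move/(congr1 (mulmx v)); rewrite mulmx0 !mulmxDr !mulmxA eY !mul_mx_scalar.
rewrite -!scalemxAl eY !scalerA -!scalerDl => /eqP; rewrite scaler_eq0 (negPf v0) orbF.
by rewrite -expr2 => /eqP.
Qed.

(** The first unit row vector is an eigenvector of every lower triangular matrix; [y^-1] transports
    it to [W]. *)
Lemma borel_eigen (W y : gl4) c d m : m != 0 -> (W ^ y = glS c d * glM m)%g ->
  exists2 v : 'rV[F]_4, v != 0 & v *m GLval W = (m * th m) *: v.
Proof.
move=> m0 e; pose v : 'rV[F]_4 := delta_mx 0 0.
have v0 : v != 0.
  apply/eqP=> /matrixP/(_ 0 0)/eqP; rewrite !mxE !eqxx oner_eq0 //.
have ev : v *m GLval (glS c d * glM m)%g = (m * th m) *: v.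
  rewrite val_glSM //; apply/matrixP=> i j; rewrite -rowE !mxE.
  rewrite (ord1 i) eqxx; case: j => [[|[|[|[|//]]]] ?];
  by rewrite -val_eqE /= ?mulr1 ?mulr0.
exists (v *m GLval y^-1%g).
  have Vy : GLval y^-1%g *m GLval y = 1%:M.
    by apply: etrans (esym (val_gl_mul y^-1%g y)) _; rewrite mulVg.
  apply: contraNneq v0 => v10; have := congr1 (mulmx^~ (GLval y)) v10.
  by rewrite /= -mulmxA Vy mulmx1 mul0mx => ->.
have yW : GLval y^-1%g *m GLval W = GLval (glS c d * glM m)%g *m GLval y^-1%g.
  apply: etrans (esym (val_gl_mul y^-1%g W)) _; apply: etrans (val_gl_mul _ _).
  by rewrite -e conjgE !mulgA mulgK.
by rewrite -mulmxA yW mulmxA ev scalemxAl.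
Qed.

Lemma coprimePn p r : (0 < p)%N -> ~~ coprime p r ->
  exists i : nat, [/\ prime i, (i %| p)%N & (i %| r)%N].
Proof.
move=> p0 g1; exists (pdiv (gcdn p r)).
have /andP[dp dr] : (pdiv (gcdn p r) %| p)%N && (pdiv (gcdn p r) %| r)%N.
  by rewrite -dvdn_gcd pdiv_dvd.
by rewrite dp dr pdiv_prime // ltn_neqAle eq_sym g1 gcdn_gt0 p0.
Qed.

(** An even order, or a prime shared with [q - 1], would conjugate [W] into the Borel subgroup. [W]
    would then have an eigenvalue in [F], giving a root of a quadratic polynomial that has none. *)
Lemma elliptic_order t W : W \in G -> quadratic_gl t W -> elliptic t ->
  odd #[W]%g /\ coprime #[W]%g q.-1.
Proof.
move=> GW quadW ell.
have noB (y : gl4) c d m : m != 0 -> (W ^ y)%g <> (glS c d * glM m)%g.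
  move=> m0 /(borel_eigen m0)[v v0 ev].
  have mm0 : m * th m != 0 by rewrite mulf_neq0 ?theta_eq0.
  have := ellipticN (plus_inv (m * th m)) ell.
  by rewrite (quadratic_eigen quadW v0 mm0 ev) eqxx.
split.
  apply: contraT => even_W; have [|y _] := conj_borel_of_even hF n_gt0 relG GW.
    by rewrite dvdn2.
  by case/(borelP relG)=> c [d [m [m0]]] /(noB _ _ _ _ m0).
apply: contraT => /(coprimePn (order_gt0 W))[p [pr_p pW pq]].
have [y [m [_ m0 e]]] := conj_torus_of_prime hF n_gt0 relG GW pr_p pq pW.
by case: (noB y 0 0 m m0); rewrite (S00 relG) mul1g.
Qed.

Lemma oppmx_char2 i j (A : 'M[F]_(i, j)) : - A = A.
Proof. by apply/matrixP=> i1 j1; rewrite mxE (oppr_pchar2 (suzuki_pchar hF)). Qed.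

(** The matrix factors as [(W + z)(W + z^-1) W^-1]. For [v] in its kernel, either [v] is an
    eigenvector for [z], or [v (W + z)] is one for [z^-1]. *)
Lemma plus_inv_eigen z (W : gl4) : z != 0 ->
  \det (GLval W + GLval W^-1%g + (plus_inv z)%:M) = 0 ->
  exists x (v : 'rV[F]_4), [/\ x != 0, plus_inv x = plus_inv z, v != 0
    & v *m GLval W = x *: v].
Proof.
move=> z0 /eqP/det0P[v v0]; rewrite !mulmxDr mul_mx_scalar => ev.
have [u0|u0] := eqVneq (v *m GLval W + z *: v) 0.
  exists z, v; split=> //; apply/eqP.
  by rewrite -subr_eq0 -[X in _ + X]/(- _) oppmx_char2 u0.
exists z^-1, (v *m GLval W + z *: v).
split; rewrite ?invr_eq0 //; first by rewrite /plus_inv invrK addrC.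
have VW : GLval W^-1%g *m GLval W = 1%:M.
  by apply: etrans (esym (val_gl_mul W^-1%g W)) _; rewrite mulVg.
apply/eqP; rewrite -subr_eq0 oppmx_char2; apply/eqP.
have := congr1 (mulmx^~ (GLval W)) ev; rewrite /= mul0mx => <-.
rewrite !mulmxDl -[v *m GLval W^-1%g *m _]mulmxA VW mulmx1 -!scalemxAl.
rewrite scalerDr scalerA mulVf // scale1r /plus_inv scalerDl.
by rewrite -!addrA; congr (_ + _); rewrite [RHS]addrC !addrA.
Qed.

Lemma scalar_shift_mul (Y : 'M[F]_4) a b :
  (Y + a%:M) *m (Y + b%:M) = Y *m Y + (a + b)%:M *m Y + (a * b)%:M.
Proof.
rewrite mulmxDl !mulmxDr mul_mx_scalar !mul_scalar_mx scalerDl scale_scalar_mx.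
by rewrite !addrA; congr (_ + _); rewrite -!addrA; congr (_ + _); apply: addrC.
Qed.

(** The split quadratic makes one of two shifts of [W + W^-1] singular. The eigenvalue found is not
    1, since [plus_inv] vanishes only at 1 among nonzero elements. *)
Lemma trM_eigen l (W : gl4) : l != 0 -> l != 1 -> quadratic_gl (trM l) W ->
  exists x (v : 'rV[F]_4), [/\ x != 0, x != 1, v != 0 & v *m GLval W = x *: v].
Proof.
move=> l0 l1; rewrite /quadratic_gl theta_trM // trM_sum -scalar_shift_mul.
have t0 : th l != 0 by rewrite theta_eq0.
have ll1 : l * th l != 1 by rewrite (mul_theta_eq1 hF).
have ll0 : l * th l != 0 by rewrite mulf_neq0.
have fin z : z != 0 -> z != 1 ->
    \det (GLval W + GLval W^-1%g + (plus_inv z)%:M) = 0 ->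
  exists x (v : 'rV[F]_4), [/\ x != 0, x != 1, v != 0 & v *m GLval W = x *: v].
  move=> z0 z1 /(plus_inv_eigen z0)[x [v [x0 exz v0 ev]]].
  by exists x, v; rewrite -plus_inv_eq0 // exz plus_inv_eq0.
move/(congr1 determinant); rewrite det_mulmx det0 => /eqP.
by rewrite mulf_eq0 => /orP[]/eqP; apply: fin.
Qed.

Lemma primitive_mul_theta l : primitive_elt (l * th l) <-> primitive_elt l.
Proof.
have e i : ((l * th l) ^+ i == 1) = (l ^+ i == 1).
  by rewrite exprMn -thetaX (mul_theta_eq1 hF).
by split=> pr i /eqP; [rewrite -e | rewrite e] => /eqP/pr.
Qed.

Lemma primitiveV l : primitive_elt l -> primitive_elt l^-1.
Proof. by move=> pr i; rewrite exprVn => /eqP; rewrite invr_eq1 => /eqP/pr. Qed.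

Lemma primitive_sqr l : primitive_elt l -> primitive_elt (l ^+ 2).
Proof. by move=> pr i; rewrite exprAC => /eqP; rewrite (sqr_eq1 hF) => /eqP/pr. Qed.

(** An eigenvalue other than 1 in [F] forces the order to share a prime with [q - 1], so [W] is
    conjugate to some [M m]. Then [m theta(m)] is [l theta(l)], [l] or an inverse of these, hence
    primitive. *)
Lemma hyperbolic_order l (W : gl4) : W \in G -> l != 0 -> l != 1 ->
  primitive_elt l -> quadratic_gl (trM l) W -> #[W]%g = q.-1.
Proof.
move=> GW l0 l1 pr_l quadW.
have [x [v [x0 x1 v0 ev]]] := trM_eigen l0 l1 quadW.
have /(coprimePn (order_gt0 W))[p [pr_p pW pq]] : ~~ coprime #[W]%g q.-1.
  apply: contra x1 => cop.
  have xW : x ^+ #[W]%g = 1.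
    have evX i : v *m GLval (W ^+ i)%g = x ^+ i *: v.
      elim: i => [|i IH]; first by rewrite mulmx1 scale1r.
      rewrite expgS exprS -scalerA -IH scalemxAl -ev -mulmxA.
      by congr (v *m _); apply: val_gl_mul.
    have := evX #[W]%g; rewrite expg_order mulmx1 => /esym/eqP.
    rewrite -subr_eq0 -{2}(scale1r v) -scalerBl scaler_eq0 (negPf v0) orbF.
    by rewrite subr_eq0 => /eqP.
  have [u w e _] := egcdnP q.-1 (order_gt0 W).
  have : x ^+ (u * #[W]%g) = 1 by rewrite mulnC exprM xW expr1n.
  rewrite e (eqP cop) exprD mulnC exprM (expf_q1 hF x0) expr1n mul1r expr1.
  by move=> ->.
have [y [m [_ m0 eW]]] := conj_torus_of_prime hF n_gt0 relG GW pr_p pq pW.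
rewrite -(orderJ W y) eW; apply: (order_M hF relG m0).
apply/primitive_mul_theta; set k := m * th m.
have k0 : k != 0 by rewrite mulf_neq0 ?theta_eq0.
have ll0 : l * th l != 0 by rewrite mulf_neq0 ?theta_eq0.
have [|w w0 ew] := @borel_eigen W y 0 0 m m0; first by rewrite (S00 relG) mul1g.
have := quadratic_eigen quadW w0 k0 ew; rewrite trM_quadratic // => /eqP.
have pr_ll : primitive_elt (l * th l) by apply/primitive_mul_theta.
rewrite mulf_eq0 !(add_eq0 hF) => /orP[]/eqP/plus_inv_inj[]// ->//; exact: primitiveV.
Qed.

(** * The two involution triples and the Beauville structure *)

Local Open Scope group_scope.
Local Notation W l b := (glT * glM l * glC b).

Lemma glC_mem b : glC b \in G.
Proof.
have GS a c : glS a c \in G by rewrite (subsetP (unip_sub relG)) // mem_S.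
by rewrite /glC !groupM ?GS ?(mem_T relG).
Qed.

Lemma glM_mem l : l != 0%R -> glM l \in G.
Proof. by move=> l0; rewrite (subsetP (torus_sub relG)) // mem_M. Qed.

Lemma glT_mem : glT \in G. Proof. exact: mem_T relG. Qed.

Lemma glTM_mem l : l != 0%R -> glT * glM l \in G.
Proof. by move=> l0; apply: groupM; [apply: glT_mem | apply: glM_mem]. Qed.

Lemma W_quadratic l b t : l != 0%R -> t = (th b * trM l)%R -> quadratic_gl t (W l b).
Proof. by move=> l0 ->; apply: glTMC_quadratic. Qed.

Lemma glC_T b : glC b * glT = glT * glC b.
Proof. by rewrite -glC1 !glC_mul addrC. Qed.

Lemma glC_neq b : b != 0%R -> b != 1%R -> glC b != 1 /\ glC b != glT.
Proof.
move=> b0 b1; split; [apply: contraNneq b0 | apply: contraNneq b1].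
  by rewrite -glC0 => /glC_inj->.
by rewrite -glC1 => /glC_inj->.
Qed.

Lemma torus_sub_gen l (K : {group gl4}) : l != 0%R -> primitive_elt l ->
  glM l \in K -> torus glM \subset K.
Proof. by move=> l0 pr Kl; rewrite -(torus_cycle hF relG l0 pr) cycle_subG. Qed.

(** Gathers the inputs of [torus_T_generate]: [M l] generates the torus, and the commuting
    involutions [C b] and [T] span the four-group. *)
Lemma suzuki_triple (r s t : gl4) l b :
  r * r = 1 -> s * s = 1 -> t * t = 1 -> [/\ r \in G, s \in G & t \in G] ->
  l != 0%R -> primitive_elt l ->
  glM l \in <<[set r; s; t]>> -> glT \in <<[set r; s; t]>> ->
  b != 0%R -> b != 1%R -> glC b \in <<[set r; s; t]>> ->
  <<[set r * s; s * t]>> = G.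
Proof.
move=> r2 s2 t2 [Gr Gs Gt] l0 pr_l Kl KT b0 b1 KC; have [C1 CT] := glC_neq b0 b1.
apply: (involution_triple_generate hF n_gt0 relG) => //.
have sKG : <<[set r; s; t]>> \subset G.
  by rewrite gen_subG; apply/subsetP=> x; rewrite !inE => /orP[/orP[]|]/eqP->.
apply/eqP; rewrite eqEsubset sKG andbT.
apply: (torus_T_generate hF n_gt0 relG) => //.
  exact: torus_sub_gen pr_l Kl.
apply: (dvd4_klein (H := <<[set r; s; t]>>%G) KC KT _ _ _ C1 _ CT).
- exact: glC_invol.
- exact: glT_mul.
- exact: glC_T.
exact: (T_neq1 relG).
Qed.

Lemma exists_primitive : exists l, [/\ l != 0%R, l != 1%R & primitive_elt l].
Proof.
have /cyclicP[u eu] := field_unit_group_cyclic [set: {unit F}]%G.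
have prim : primitive_elt (val u).
  move=> i e; have : u ^+ i = 1 by apply: val_inj; rewrite FinRing.val_unitX e.
  by move/eqP; rewrite -order_dvdn orderE -eu /= card_finField_unit.
exists (val u); split=> //; first by rewrite -unitfE; apply: valP.
apply/eqP=> u1; have := prim 1%N; rewrite expr1 u1 dvdn1 => /(_ erefl)/eqP.
have := q_ge8 hF n_gt0; lia.
Qed.

Lemma hyperbolic_triple : exists r s t : gl4,
  [/\ [/\ r * r = 1, s * s = 1 & t * t = 1], [/\ r \in G, s \in G & t \in G],
      <<[set r * s; s * t]>> = G
    & [/\ #[r * s] = q.-1, #[s * t] = q.-1 & #[r * t] = q.-1]].
Proof.
have [l [l0 l1 pr_l]] := exists_primitive.
have [b eb] := theta_onto hF (trM l).
have V0 : l^-1%R != 0%R by rewrite invr_eq0.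
have b0 : b != 0%R by rewrite -(theta_eq0 n) eb trM_eq0.
have b1 : b != 1%R by rewrite -(theta_eq1 hF) eb trM_neq1.
have ers : glT * glM l * (glT * glM l^-1%R) = glM (l^-1 ^+ 2)%R.
  rewrite (T_mulM relG l0) -mulgA (mulgA glT) glT_mul mul1g.
  by rewrite glM_mul // expr2.
exists (glT * glM l), (glT * glM l^-1%R), (glC b); split.
- by rewrite !glTM_invol // glC_invol.
- by split; rewrite ?glTM_mem ?glC_mem.
- have pr2 : primitive_elt (l^-1 ^+ 2)%R by apply/primitive_sqr/primitiveV.
  have V20 : (l^-1 ^+ 2)%R != 0%R by rewrite expf_neq0.
  have Kr : glT * glM l \in <<[set glT * glM l; glT * glM l^-1%R; glC b]>>.
    by rewrite mem_gen // !inE eqxx.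
  have Ks : glT * glM l^-1%R \in <<[set glT * glM l; glT * glM l^-1%R; glC b]>>.
    by rewrite mem_gen // !inE eqxx orbT.
  have Krs := groupM Kr Ks; rewrite ers in Krs.
  apply: (suzuki_triple _ _ _ _ V20 pr2 Krs _ b0 b1).
  + exact: glTM_invol.
  + exact: glTM_invol.
  + exact: glC_invol.
  + by split; rewrite ?glTM_mem ?glC_mem.
  + have KV : glM l^-1%R \in <<[set glT * glM l; glT * glM l^-1%R; glC b]>>.
      by apply: (subsetP (torus_sub_gen V20 pr2 Krs)); apply: mem_M.
    have := groupM Kr KV.
    by rewrite -mulgA glM_mul // divff // (M1 relG) mulg1.
  + by rewrite mem_gen // !inE eqxx !orbT.
have oW : #[glT * glM l * glC b] = q.-1.
  apply: (@hyperbolic_order (l ^+ 2)%R).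
  - by apply: groupM; [apply: glTM_mem | apply: glC_mem].
  - by rewrite expf_neq0.
  - by rewrite (sqr_eq1 hF).
  - exact: primitive_sqr.
  by apply: W_quadratic; rewrite // eb trM_sqr expr2.
split=> //.
  rewrite ers; apply: (order_M hF relG); first by rewrite expf_neq0.
  by apply/primitive_sqr/primitiveV.
(* [T] commutes with [C b] and inverts [M l], so conjugation by [T] turns [T M(l) C(b)] into
   [T M(l^-1) C(b)]. *)
rewrite -oW -[RHS](orderJ _ glT) conjgE.
have -> : glT^-1 = glT by apply: (mulgI glT); rewrite mulgV glT_mul.
congr #[_].
by rewrite -(mulgA _ (glC b)) glC_T !mulgA glT_mul mul1g glM_mulT.
Qed.

Lemma elliptic_triple : exists r s t : gl4,
  [/\ [/\ r * r = 1, s * s = 1 & t * t = 1], [/\ r \in G, s \in G & t \in G],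
      <<[set r * s; s * t]>> = G,
      [/\ odd #[r * s], coprime #[r * s] q.-1, odd #[s * t] & coprime #[s * t] q.-1]
    & #[r * t] = 2].
Proof.
have [l [l0 l1 pr_l]] := exists_primitive.
have tr0 : trM l != 0%R by rewrite trM_eq0.
have [u [v [ell_u ell_v uv]]] := elliptic_sum tr0 (trM_not_elliptic l0).
(* The choice of [b] and [c] gives the two products the traces [u] and [v], while [b + c = 1] makes
   [C b * C c] equal to [T]. *)
have [b eb] := theta_onto hF (u / trM l)%R; pose c := (1 + b)%R.
have ec : th c = (v / trM l)%R.
  rewrite /c (thetaD hF) theta1 eb -(divff tr0) -mulrDl -uv; congr (_ / _)%R.
  by rewrite addrAC (addxx hF) add0r.
have b0 : b != 0%R.
  by rewrite -(theta_eq0 n) eb mulf_neq0 ?invr_eq0 // elliptic_neq0.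
have b1 : b != 1%R.
  by rewrite eq_sym -(add_eq0 hF) -(theta_eq0 n) ec mulf_neq0 ?invr_eq0 // elliptic_neq0.
have quad d w : th d = (w / trM l)%R -> quadratic_gl w (W l d).
  by move=> ed; apply: W_quadratic; rewrite // ed divfK.
have GW d : W l d \in G by apply: groupM; [apply: glTM_mem | apply: glC_mem].
have [odd_b cop_b] := elliptic_order (GW b) (quad _ _ eb) ell_u.
have [odd_c cop_c] := elliptic_order (GW c) (quad _ _ ec) ell_v.
have o_rs : #[glC b * (glT * glM l)] = #[W l b].
  rewrite -(gl_involg_mul (glTM_invol l0) (glC_invol b)); exact: orderV.
have ert : glC b * glC c = glT.
  by rewrite glC_mul // /c addrCA (addxx hF) addr0 glC1.
exists (glC b), (glT * glM l), (glC c); split.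
- by rewrite !glC_invol // glTM_invol.
- by split; rewrite ?glTM_mem ?glC_mem.
- have Kr : glC b \in <<[set glC b; glT * glM l; glC c]>>.
    by rewrite mem_gen // !inE eqxx.
  have Ks : glT * glM l \in <<[set glC b; glT * glM l; glC c]>>.
    by rewrite mem_gen // !inE eqxx orbT.
  have Kt : glC c \in <<[set glC b; glT * glM l; glC c]>>.
    by rewrite mem_gen // !inE eqxx !orbT.
  have KT := groupM Kr Kt; rewrite ert in KT.
  have Kl := groupM KT Ks; rewrite mulgA glT_mul mul1g in Kl.
  apply: (suzuki_triple _ _ _ _ l0 pr_l Kl KT b0 b1 Kr).
  + exact: glC_invol.
  + exact: glTM_invol.
  + exact: glC_invol.
  + by split; rewrite ?glTM_mem ?glC_mem.
- by rewrite o_rs.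
by rewrite ert; apply: (order_T relG).
Qed.

Lemma strongly_real_triple (r1 s1 t1 r2 s2 t2 : gl4) :
  s1 \in G -> s2 \in G ->
  [/\ r1 * r1 = 1, s1 * s1 = 1 & t1 * t1 = 1] ->
  [/\ r2 * r2 = 1, s2 * s2 = 1 & t2 * t2 = 1] ->
  strongly_real G (r1 * s1, s1 * t1) (r2 * s2, s2 * t2).
Proof.
move=> Gs1 Gs2 [r12 s12 t12] [r22 s22 t22].
have inv (r s t : gl4) : r * r = 1 -> s * s = 1 -> t * t = 1 ->
    s * (r * s) * s^-1 = (r * s)^-1 /\ s * (s * t) * s^-1 = (s * t)^-1.
  move=> hr hs ht; rewrite (gl_involg_mul hr hs) (gl_involg_mul hs ht).
  have -> : s^-1 = s by apply: (mulgI s); rewrite mulgV hs.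
  by split; [rewrite -!mulgA hs mulg1 | rewrite mulgA hs mul1g].
exists 1; first exact: group1.
by exists s1, s2; rewrite !perm1 /=; split=> //; apply: inv.
Qed.

Lemma suzuki_beauville : exists (X1 X2 : gl4 * gl4) (d1 d2 : nat),
  [/\ beauville_structure G X1 X2, strongly_real G X1 X2,
      beauville_type X1 X2 = ((q.-1, q.-1, q.-1), (d1, d2, 2)),
      odd d1 /\ odd d2 & coprime d1 q.-1 /\ coprime d2 q.-1].
Proof.
have [r1 [s1 [t1 [inv1 [Gr1 Gs1 Gt1] gen1 [o1 o2 o3]]]]] := hyperbolic_triple.
have [r2 [s2 [t2 [inv2 [Gr2 Gs2 Gt2] gen2 [odd1 cop1 odd2 cop2] o6]]]] :=
  elliptic_triple.
have prod (r s t : gl4) : s * s = 1 -> r * s * (s * t) = r * t.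
  by move=> ss; rewrite -mulgA (mulgA s) ss mul1g.
have [_ s1s1 _] := inv1; have [_ s2s2 _] := inv2.
exists (r1 * s1, s1 * t1), (r2 * s2, s2 * t2), #[r2 * s2], #[s2 * t2].
split=> //.
(* [j] is a common multiple of the three orders of the second pair; it is prime to [q - 1], which is
   odd. *)
- split=> //=; pose j := (#[r2 * s2]%g * #[s2 * t2]%g * 2)%N.
  apply: (@Sigma_coprime _ _ _ _ _ _ q.-1 j);
    rewrite ?groupM ?prod ?o1 ?o2 ?o3 ?o6 //.
  + by rewrite /j -mulnA dvdn_mulr.
  + by rewrite /j mulnAC dvdn_mull.
  + by rewrite /j dvdn_mull.
  rewrite /j !coprimeMr coprime_sym cop1 coprime_sym cop2 /= coprimen2.
  have := q_even hF; have := q_gt1 hF.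
  by case: #|F| => // i _ /=; rewrite negbK.
- exact: strongly_real_triple.
by rewrite /beauville_type /= !prod // o1 o2 o3 o6.
Qed.

End SuzukiMatrices.

Theorem theorem9 (n q : nat) (F : finFieldType)
    (hn : 1 <= n) (hq : q = 2 ^ (2 * n + 1)) (hF : #|F| = q) :
  exists (X1 X2 : {'GL_4[F]} * {'GL_4[F]}) (d1 d2 : nat),
    [/\ beauville_structure (suzuki_group n F) X1 X2,
        strongly_real (suzuki_group n F) X1 X2,
        beauville_type X1 X2 = ((q - 1, q - 1, q - 1), (d1, d2, 2)),
        odd d1 /\ odd d2
      & coprime d1 (q - 1) /\ coprime d2 (q - 1)].
Proof.
move: hF; rewrite {}hq subn1 => hF; rewrite -hF.
exact: suzuki_beauville.
Qed.
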